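(* Let $n$ be a positive integer. If $h:[n]\to[n]$ is an indecomposable Hessenberg function, then there is an isomorphism of $\mathbb{C}$-algebras $$\mathbb{C}[\mathrm{Hess}(N,h)\cap\Omega_e^\circ]\;\cong\;\frac{\mathbb{C}[x_1,\ldots,x_n,\,q_{rs}\mid 2\le s\le n,\ n-h(n+1-s)<r<s]}{({}^hE_1^{(n)},\ldots,{}^hE_n^{(n)})},$$ where $\mathbb{C}[\mathrm{Hess}(N,h)\cap\Omega_e^\circ]$ is the coordinate ring of the open set $\mathrm{Hess}(N,h)\cap\Omega_e^\circ$ in $\mathrm{Hess}(N,h)$.
   Context: Write $[n]=\{1,\ldots,n\}$. A Hessenberg function is a nondecreasing function $h:[n]\to[n]$ with $h(j)\ge j$ for all $j\in[n]$; it is indecomposable if $h(j)>j$ for all $j\in[n-1]$. $Fl(\mathbb{C}^n)$ is the variety of full flags $V_\bullet=(V_1\subset\cdots\subset V_n=\mathbb{C}^n)$, $\dim V_i=i$, identified with $\mathrm{GL}_n(\mathbb{C})/B$ ($B$ = upper triangular invertible matrices) by letting the first $j$ columns of $g$ span $V_j$. Let $N$ be the $n\times n$ nilpotent matrix consisting of a single Jordan block ($N_{i,i+1}=1$, all other entries $0$). The regular nilpotent Hessenberg variety is the (reduced) closed subvariety $$\mathrm{Hess}(N,h)=\{V_\bullet\in Fl(\mathbb{C}^n)\mid NV_i\subset V_{h(i)}\text{ for all }i\in[n]\}.$$ $\Omega_e^\circ$ is the opposite Schubert cell of the identity, i.e. the orbit of $eB$ under the group $B^-$ of lower triangular invertible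 matrices; it is an open affine subset of $Fl(\mathbb{C}^n)$, identified with the set of lower triangular unipotent $n\times n$ matrices. Let $M_n$ be the $n\times n$ matrix with diagonal entries $x_1,\ldots,x_n$, entries $-1$ in positions $(i+1,i)$, entry $q_{rs}$ in position $(r,s)$ for $1\le r<s\le n$, and zeros elsewhere. Define $E_1^{(n)},\ldots,E_n^{(n)}\in\mathbb{C}[x_1,\ldots,x_n,q_{rs}\mid 1\le r<s\le n]$ by $$\det(\lambda I_n-M_n)=\lambda^n-E_1^{(n)}\lambda^{n-1}+E_2^{(n)}\lambda^{n-2}+\cdots+(-1)^nE_n^{(n)}.$$ Define ${}^hE_i^{(n)}$ to be the polynomial obtained from $E_i^{(n)}$ by setting $q_{rs}=0$ for all $2\le s\le n$ and $1\le r\le n-h(n+1-s)$. *)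

(* Defs.v *)
From HB Require Import structures.
From mathcomp Require Import all_boot all_order all_algebra.
From mathcomp Require Import ring_quotient mpoly.
From mathcomp Require Import boolp reals.
From mathcomp Require Import complex.

Set Implicit Arguments.
Unset Strict Implicit.
Unset Printing Implicit Defensive.

Import Order.TTheory GRing.Theory Num.Theory.
Local Open Scope ring_scope.
Local Open Scope quotient_scope.

(* Throughout, [n] = {1, ..., n} is encoded as 'I_n = {0, ..., n-1}: the
   number a in [n] is the ordinal of value a-1.  The ring C is R[i] for an
   arbitrary model R of the real numbers. *)

Definition quot_alg (K : comNzRingType) (A : comAlgType K) (I : idealr A) :
  Type := {ideal_quot I}.

Section QuotAlg.
Variables (K : comNzRingType) (A : comAlgType K) (I : idealr A).

HB.instance Definition _ := GRing.ComNzRing.copy (quot_alg I) {ideal_quot I}.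

Definition quot_pi (a : A) : quot_alg I := \pi_{ideal_quot I} a.

Definition quot_scale (c : K) (x : quot_alg I) : quot_alg I :=
  quot_pi (c%:A) * x.

Lemma quot_piM a b : quot_pi (a * b) = quot_pi a * quot_pi b.
Proof. exact: (rmorphM (\pi_{ideal_quot I} : {rmorphism A -> _})). Qed.

Lemma quot_piD a b : quot_pi (a + b) = quot_pi a + quot_pi b.
Proof. exact: (rmorphD (\pi_{ideal_quot I} : {rmorphism A -> _})). Qed.

Lemma quot_pi1 : quot_pi 1 = 1.
Proof. exact: (rmorph1 (\pi_{ideal_quot I} : {rmorphism A -> _})). Qed.

Lemma quot_scaleA a b v : quot_scale a (quot_scale b v) = quot_scale (a * b) v.
Proof. by rewrite /quot_scale mulrA -quot_piM -scalerAl mul1r scalerA. Qed.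

Lemma quot_scale1 : left_id 1 quot_scale.
Proof. by move=> v; rewrite /quot_scale scale1r quot_pi1 mul1r. Qed.

Lemma quot_scaleDr : right_distributive quot_scale +%R.
Proof. by move=> c u v; rewrite /quot_scale mulrDr. Qed.

Lemma quot_scaleDl v : {morph quot_scale^~ v : a b / a + b}.
Proof. by move=> a b; rewrite /quot_scale scalerDl quot_piD mulrDl. Qed.

HB.instance Definition _ := GRing.Zmodule_isLmodule.Build K (quot_alg I)
  quot_scaleA quot_scale1 quot_scaleDr quot_scaleDl.

Lemma quot_scaleAl (c : K) (u v : quot_alg I) : c *: (u * v) = (c *: u) * v.
Proof. by rewrite /GRing.scale /= /quot_scale mulrA. Qed.

HB.instance Definition _ :=
  GRing.Lmodule_isLalgebra.Build K (quot_alg I) quot_scaleAl.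

Lemma quot_scaleAr (c : K) (u v : quot_alg I) : c *: (u * v) = u * (c *: v).
Proof. by rewrite /GRing.scale /= /quot_scale mulrCA. Qed.

HB.instance Definition _ :=
  GRing.Lalgebra_isAlgebra.Build K (quot_alg I) quot_scaleAr.

Lemma quot_piZ c a : quot_pi (c *: a) = c *: quot_pi a.
Proof. by rewrite {2}/GRing.scale /= /quot_scale -quot_piM -scalerAl mul1r. Qed.

End QuotAlg.

Definition gen_ideal (A : comNzRingType) (k : nat) (F : 'I_k -> A) : A -> bool :=
  fun a => `[< exists c : 'I_k -> A, a = \sum_(i < k) c i * F i >].

Definition vanishing_ideal (K : comNzRingType) (m : nat)
    (Z : ('I_m -> K) -> Prop) : {mpoly K[m]} -> bool :=
  fun p => `[< forall y, Z y -> p.@[y] = 0 >].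

Lemma vanishing_ideal_closed (K : comNzRingType) (m : nat)
    (Z : ('I_m -> K) -> Prop) (y0 : 'I_m -> K) :
  Z y0 -> idealr_closed (vanishing_ideal Z).
Proof.
move=> Zy0; split.
- by apply/asboolP => y _; rewrite meval0.
- apply/negP => /asboolP /(_ _ Zy0) /eqP.
  by rewrite meval1 oner_eq0.
- move=> a u v /asboolP hu /asboolP hv; apply/asboolP => y Zy.
  by rewrite mevalD mevalM hu // hv // mulr0 addr0.
Qed.

Record hessenberg (n : nat) := Hessenberg {
  hess_fun :> 'I_n -> 'I_n;
  hess_mono : forall i j : 'I_n, (i <= j)%N -> (hess_fun i <= hess_fun j)%N;
  hess_ge : forall j : 'I_n, (j <= hess_fun j)%N }.

Definition indecomposable (n : nat) (h : hessenberg n) : Prop :=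
  forall j : 'I_n, (j.+1 < n)%N -> (j < h j)%N.

Section Flags.
Variables (K : fieldType) (n : nat).

(* V i is the subspace V_{i+1} of the flag. *)
Definition is_flag (V : 'I_n -> {vspace 'cV[K]_n}) : Prop :=
  (forall i : 'I_n, \dim (V i) = i.+1) /\
  (forall i j : 'I_n, (i <= j)%N -> (V i <= V j)%VS).

(* The flag corresponding to the coset gB. *)
Definition flag_of (g : 'M[K]_n) (j : 'I_n) : {vspace 'cV[K]_n} :=
  <<take j.+1 [seq col k g | k : 'I_n]>>%VS.

Definition jordan_nilp : 'M[K]_n :=
  \matrix_(i, j) ((j == i.+1 :> nat)%:R).

Definition in_Hess (h : hessenberg n) (V : 'I_n -> {vspace 'cV[K]_n}) : Prop :=
  is_flag V /\
  forall i : 'I_n,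
    (linfun (mulmx jordan_nilp : 'cV[K]_n -> 'cV[K]_n) @: V i <= V (h i))%VS.

Definition lower_borel (b : 'M[K]_n) : Prop :=
  b \in unitmx /\ forall i j : 'I_n, (i < j)%N -> b i j = 0.

(* The orbit of eB under lower_borel: b . eB = bB is flag_of b. *)
Definition in_opp_cell (V : 'I_n -> {vspace 'cV[K]_n}) : Prop :=
  exists2 b, lower_borel b & V =1 flag_of b.

(* Affine coordinates on the opposite cell: a tuple (y_{ij})_{i > j} is sent
   to the flag of the lower unipotent matrix with these entries. *)
Definition low_pos := {p : 'I_n * 'I_n | (p.2 < p.1)%N}.

Definition lower_unip (y : 'I_#|{: low_pos}| -> K) : 'M[K]_n :=
  \matrix_(i, j)
    if insub (i, j) is Some t then y (enum_rank (t : low_pos))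
    else (i == j)%:R.

Definition Hess_cell_points (h : hessenberg n) (y : 'I_#|{: low_pos}| -> K) :
    Prop :=
  in_Hess h (flag_of (lower_unip y)) /\ in_opp_cell (flag_of (lower_unip y)).

Definition Hess_cell_ideal (h : hessenberg n) :
    {mpoly K[#|{: low_pos}|]} -> bool :=
  vanishing_ideal (Hess_cell_points h).

Lemma flag_of_is_flag g : g \in unitmx -> is_flag (flag_of g).
Proof.
move=> gU.
have fr : free [seq col k g | k : 'I_n].
  have szn : size [seq col k g | k : 'I_n] == n
    by rewrite size_map -cardE card_ord.
  rewrite -[X in free X]/(tval (Tuple szn)).
  apply/freeP => c /= c0 i.
  have : g *m (\col_k c k) = 0.
    rewrite -[RHS]c0; apply/matrixP => a b; rewrite !mxE summxE.
    apply: eq_bigr => k _.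
    rewrite (nth_map i) ?size_enum_ord // nth_ord_enum !mxE.
    by rewrite mulrC.
  move/(congr1 (mulmx (invmx g))); rewrite mulKmx // mulmx0.
  by move/matrixP/(_ i 0); rewrite !mxE.
have sz : size [seq col k g | k : 'I_n] = n by rewrite size_map -cardE card_ord.
split=> [i | i j ij].
  have /eqP -> : free (take i.+1 [seq col k g | k : 'I_n]).
    by move: fr; rewrite -{1}(cat_take_drop i.+1 [seq _ | _ : _]) cat_free => /and3P[].
  by rewrite size_takel ?sz.
apply: sub_span => v; rewrite -(take_takel _ (_ : i.+1 <= j.+1)%N) //.
by move=> vt; apply: mem_take vt.
Qed.

Lemma lower_unip0 : lower_unip (fun=> 0) = 1%:M.
Proof.
apply/matrixP => i j; rewrite !mxE; case: insubP => //= t.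
by move=> ij _; case: eqP ij => // ->; rewrite ltnn.
Qed.

Lemma in_Hess_std (h : hessenberg n) : in_Hess h (flag_of 1%:M).
Proof.
split; first exact: flag_of_is_flag (unitmx1 _ _).
move=> i; rewrite limg_span; apply/span_subvP => _ /mapP[v vin ->].
rewrite lfunE /=.
have sz : size [seq col k (1%:M : 'M[K]_n) | k : 'I_n] = n
  by rewrite size_map -cardE card_ord.
have nthE (k : 'I_n) : nth 0 [seq col l (1%:M : 'M[K]_n) | l : 'I_n] k
    = col k 1%:M.
  by rewrite (nth_map k) ?size_enum_ord // nth_ord_enum.
case/(nthP 0): vin => k; rewrite size_take_min sz leq_min => /andP[ki kn].
rewrite nth_take // -[k]/(val (Ordinal kn)) nthE => <-.
case: k kn ki => [|k] kn ki.
  suff -> : jordan_nilp *m col (Ordinal kn) 1%:M = 0 by exact: mem0v.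
  by rewrite colE mulmxA mulmx1 -colE; apply/matrixP => a b; rewrite !mxE.
have kn' : (k < n)%N by exact: ltnW.
have -> : jordan_nilp *m col (Ordinal kn) 1%:M = col (Ordinal kn') 1%:M.
  rewrite colE mulmxA mulmx1 -colE; apply/matrixP => a b; rewrite !mxE.
  by rewrite eqSS /eq_op /= eq_sym.
have kh : (k < (h i).+1)%N.
  by rewrite ltnS (leq_trans _ (hess_ge h i)) // -ltnS ltnW.
apply: memv_span; rewrite -nthE -(nth_take _ kh).
by rewrite mem_nth // size_take_min sz leq_min kh.
Qed.

Lemma Hess_cell_ideal_closed (h : hessenberg n) :
  idealr_closed (Hess_cell_ideal h).
Proof.
apply: (@vanishing_ideal_closed _ _ _ (fun=> 0)).
rewrite /Hess_cell_points lower_unip0; split; first exact: in_Hess_std.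
exists 1%:M => //; split; first exact: unitmx1.
by move=> i j ij; rewrite !mxE; case: eqP ij => // ->; rewrite ltnn.
Qed.

HB.instance Definition _ (h : hessenberg n) :=
  isIdealr.Build _ (Hess_cell_ideal h) (Hess_cell_ideal_closed h).

End Flags.
Arguments Hess_cell_ideal K {n} h.

(* The coordinate ring of the reduced closed subvariety of the affine space
   with coordinates y whose points are Hess_cell_points. *)
Definition Hess_cell_coord_ring (R : realType) (n : nat) (h : hessenberg n) :=
  quot_alg (Hess_cell_ideal R[i] h).

Section QuantumElementary.
Variables (K : comNzRingType) (n : nat).

Definition q_index := {p : 'I_n * 'I_n | (p.1 < p.2)%N}.
Definition full_var := ('I_n + q_index)%type.

Definition var_x (i : 'I_n) : {mpoly K[#|{: full_var}|]} :=
  'X_(enum_rank (inl i : full_var)).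
Definition var_q (t : q_index) : {mpoly K[#|{: full_var}|]} :=
  'X_(enum_rank (inr t : full_var)).

Definition matM : 'M[{mpoly K[#|{: full_var}|]}]_n :=
  \matrix_(r, s)
    if r == s then var_x r
    else if r == s.+1 :> nat then -1
    else if insub (r, s) is Some t then var_q t else 0.

(* E_poly i is E_i^{(n)}, meaningful for 1 <= i <= n. *)
Definition E_poly (i : nat) : {mpoly K[#|{: full_var}|]} :=
  (-1) ^+ i * (char_poly matM)`_(n - i).

Variable h : hessenberg n.

(* n - h(n+1-s) < r < s, where r, s (and h) have 1-based values r.+1, s.+1,
   and the ordinal of value n+1-s (1-based) is rev_ord s. *)
Definition q_kept (p : 'I_n * 'I_n) : bool :=
  let: (r, s) := p in (n - (h (rev_ord s)).+1 < r.+1 < s.+1)%N.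

Definition hq_index := {p : 'I_n * 'I_n | q_kept p}.
Definition hvar := ('I_n + hq_index)%type.

(* x_i is kept; q_rs is kept if it is a variable of the smaller ring, that is
   unless 1 <= r <= n - h(n+1-s), and is otherwise replaced by 0. *)
Definition hsubst (v : full_var) : {mpoly K[#|{: hvar}|]} :=
  match v with
  | inl i => 'X_(enum_rank (inl i : hvar))
  | inr t => if insub (val t) is Some t'
             then 'X_(enum_rank (inr (t' : hq_index) : hvar)) else 0
  end.

Definition hE (i : nat) : {mpoly K[#|{: hvar}|]} :=
  E_poly i \mPo [tuple hsubst (enum_val k) | k < #|{: full_var}|].

Definition hE_ideal : {mpoly K[#|{: hvar}|]} -> bool :=
  gen_ideal (fun i : 'I_n => hE i.+1).

Lemma hE_at0 (i : 'I_n) : (hE i.+1).@[fun=> 0] = 0.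
Proof.
rewrite /hE comp_mpoly_meval; set v := (X in meval X).
have v0 k : v k = 0.
  rewrite /v tnth_mktuple; case: (enum_val k) => [j|t] /=; first exact: mevalXU.
  by case: insub => [t'|]; [exact: mevalXU | exact: meval0].
rewrite /E_poly mevalM; set c := (char_poly matM)`_ _.
have -> : c.@[v] = (char_poly (map_mx (meval v) matM))`_(n - i.+1).
  by rewrite -map_char_poly coef_map.
suff -> : char_poly (map_mx (meval v) matM) = 'X^n.
  by rewrite coefXn -[X in _ == X]subn0 eqn_sub2lE ?mulr0.
rewrite char_poly_trig; last first.
  apply/is_trig_mxP => a b ab; rewrite !mxE.
  case: eqP ab => [-> | _ ab]; first by rewrite ltnn.
  rewrite ltn_eqF ?(leqW ab) //.
  by case: insubP => [t _ _|_]; rewrite ?mevalXU ?v0 ?meval0.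
rewrite (eq_bigr (fun=> 'X)) ?prodr_const ?card_ord // => j _.
by rewrite !mxE eqxx mevalXU v0 subr0.
Qed.

Lemma hE_ideal_closed : idealr_closed hE_ideal.
Proof.
split.
- apply/asboolP; exists (fun=> 0).
  by rewrite big1 // => i _; rewrite mul0r.
- apply/negP => /asboolP[c /(congr1 (meval (fun=> 0)))] /eqP.
  rewrite meval1 rmorph_sum big1 ?oner_eq0 // => i _.
  by rewrite rmorphM /= hE_at0 mulr0.
- move=> a u v /asboolP[c ->] /asboolP[d ->]; apply/asboolP.
  exists (fun i => a * c i + d i).
  rewrite mulr_sumr -big_split; apply: eq_bigr => i _ /=.
  by rewrite mulrDl mulrA.
Qed.

HB.instance Definition _ := isIdealr.Build _ hE_ideal hE_ideal_closed.

End QuantumElementary.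
Arguments hE_ideal K {n} h.

Definition hE_quotient (R : realType) (n : nat) (h : hessenberg n) :=
  quot_alg (hE_ideal R[i] h).

(* Main.v *)
From HB Require Import structures.
Require Import Defs.
From mathcomp Require Import all_boot all_order all_algebra.
From mathcomp Require Import fraction ring_quotient ssrcomplements mpoly.
From mathcomp Require Import boolp classical_sets reals complex.
From mathcomp Require Import ring lra zify.

Set Implicit Arguments.
Unset Strict Implicit.
Unset Printing Implicit Defensive.

Import Order.TTheory GRing.Theory Num.Theory.
Local Open Scope ring_scope.

(** The lower unipotent matrices [g] are coordinates on the cell.  Put
[W = g^-1 N g].  Because [N] shifts rows, [g W = N g] says that each row of
[g] is the previous one times [W], and that the last row times [W] is zero.
The first row is the first basis vector [e], so the rows are [e W^i] and
[e W^n = 0].  Conversely, a matrix [W] with ones just above the diagonal,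
zeros further up and [e W^n = 0] comes from exactly one [g].  The flag lies in
the Hessenberg variety when [W a b = 0] for [h b < a].  A half turn and a
change of sign carry [W] to the matrix [M_n] in which the dropped [q_rs] are
zero.  The two passages are polynomial in both directions
([flag_at_in], [matrix_at_in], [matrix_at_flag_at]), so the points of the cell
and the common zeros of the equations [e W^n = 0] are isomorphic.  By
Cayley-Hamilton these equations generate the same ideal as the coefficients
of the characteristic polynomial ([generated_last_row_pow]), that is, the
ideal in the theorem.

It remains to see that this ideal contains every polynomial vanishing at its
zeros.  By the Nullstellensatz, proved here from the uncountability of the
complex numbers, it is enough that the ideal is radical, and this is where
indecomposability enters.

Write the last row of [M^n] as polynomials in the [x_i], over any domain in
which the [q_rs] take their values.  For the degree-lexicographic order, entry
[k] has leading monomial [x_k^(k+1)], columns and variables being counted from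
0, whatever the [q_rs] are ([mlead_last_row_pow]).  Modulo polynomials with such
leading monomials, normal forms exist and are unique ([normal_form],
[reduced_ideal_eq0]).  So the quotient is a free module over the ring of
coefficients, and a nonzero coefficient is never a zero divisor in it.

Multiply by a parameter [t] all the [q_rs] which are not on the first
superdiagonal.  A nilpotent normal form vanishes at [t = 0] if the quotient
there is reduced; then it is divisible by [t], and dividing by [t] keeps it
nilpotent.  Hence reducedness at [t = 0] is enough ([radical_specialization]).
Indecomposability keeps all of the first superdiagonal, so at [t = 0] one finds
a tridiagonal matrix with independent parameters.

For a tridiagonal matrix the characteristic polynomials [P_k] of the leading
blocks satisfy a three-term recurrence, and [P_n] is [X^n] modulo the ideal.  Read
downwards, the recurrence is the Euclidean algorithm for [X^n] and [P_(n-1)],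
so it expresses all [x_i] and [q_i] as fractions in the coefficients of
[P_(n-1)].  The denominators become nonzero constants in the quotient, where
they are not zero divisors.  The quotient therefore embeds into a field of
rational functions, and it has no nilpotents ([radical_jacobi]). *)

(** * The real numbers are uncountable *)
Section Uncountable.
Variable R : realType.

(** Cantor's nested intervals: the [k]-th step keeps an outer third of the current
interval which misses [a k], and the supremum of the left ends lies in all the
intervals. *)
Lemma real_not_enumerable (a : nat -> R) : exists x, forall k, a k != x.
Proof.
pose step k (u : R * R) :=
  if a k <= (2 * u.1 + u.2) / 3 then ((u.1 + 2 * u.2) / 3, u.2)
  else (u.1, (2 * u.1 + u.2) / 3).
pose I := fix I k : R * R := if k is k'.+1 then step k' (I k') else (0, 1).
have I_lt k : (I k).1 < (I k).2.
  by elim: k => /= [|k IH]; [lra|rewrite /step; case: ifP => _ /=; lra].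
have I_mono k : ((I k).1 <= (I k.+1).1) && ((I k.+1).2 <= (I k).2).
  by have := I_lt k; rewrite /= /step; case: ifP => _ /=; lra.
have I_monoD k l : ((I k).1 <= (I (k + l)%N).1) && ((I (k + l)%N).2 <= (I k).2).
  elim: l => [|l IH]; first by rewrite addn0 !lexx.
  by have := I_mono (k + l)%N; rewrite addnS; lra.
have I_cross k l : (I k).1 <= (I l).2.
  have := I_monoD k l; have := I_monoD l k; have := I_lt (k + l)%N.
  by rewrite [(l + k)%N]addnC; lra.
pose E (x : R) : Prop := exists k, x = (I k).1.
have E_sup : has_sup E.
  split; first by exists (I 0).1, 0%N.
  by exists (I 0).2 => _ [k ->].
have le_sup k : (I k).1 <= sup E by apply: ub_le_sup; [case: E_sup|exists k].
have sup_le k : sup E <= (I k).2.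
  by apply: ge_sup; [case: E_sup|move=> _ [l ->]].
exists (sup E) => k; apply/eqP => ak.
have := le_sup k.+1; have := sup_le k.+1; have := I_lt k.
rewrite /= /step -ak; case: ifP => /= [|/negbT]; first lra.
rewrite -ltNge; lra.
Qed.

(** Pigeonhole in the form needed for the Nullstellensatz: if every fiber were
finite, listing them one after the other would enumerate the reals. *)
Lemma real_infinite_fiber (e : R -> nat) :
  exists j, forall s : seq R, exists2 x, x \notin s & e x = j.
Proof.
apply: contrapT => noj.
have /choice[s sP] : forall j, exists s : seq R, forall x, e x = j -> x \in s.
  move=> j; apply: contrapT => nos; apply: noj; exists j => s.
  apply: contrapT => nox; apply: nos; exists s => x exj.
  by apply: contrapT => /negP xs; apply: nox; exists x.
pose a k := if unpickle k is Some (i, j) then nth 0 (s i) j else 0.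
have [x ax] := real_not_enumerable a.
have /eqP := ax (pickle (e x, index x (s (e x)))); apply.
by rewrite /a pickleK nth_index // sP.
Qed.
End Uncountable.

(** * The Nullstellensatz over an uncountable algebraically closed field *)
(** Ideals as predicates in [Prop], possibly improper: the constructions below
adjoin elements to an ideal before it is known to stay proper. *)
Definition ideal_pred (A : comNzRingType) (J : A -> Prop) : Prop :=
  [/\ J 0, forall a b, J a -> J b -> J (a + b) & forall a b, J b -> J (a * b)].

Section IdealPred.
Variables (A : comNzRingType) (J : A -> Prop).
Hypothesis idJ : ideal_pred J.

Lemma ideal_zero : J 0. Proof. by case: idJ. Qed.
Lemma ideal_add a b : J a -> J b -> J (a + b). Proof. by case: idJ => _ + _; apply. Qed.
Lemma ideal_mull a b : J b -> J (a * b). Proof. by case: idJ => _ _; apply. Qed.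
Lemma ideal_mulr a b : J a -> J (a * b). Proof. by rewrite mulrC; apply: ideal_mull. Qed.
Lemma ideal_opp a : J a -> J (- a). Proof. by rewrite -mulN1r; apply: ideal_mull. Qed.
Lemma ideal_sub a b : J a -> J b -> J (a - b).
Proof. by move=> Ja Jb; apply/ideal_add/ideal_opp. Qed.
Lemma ideal_sum (I : Type) (r : seq I) (P : pred I) (F : I -> A) :
  (forall i, P i -> J (F i)) -> J (\sum_(i <- r | P i) F i).
Proof.
by move=> JF; elim/big_ind: _ => //; [exact: ideal_zero|exact: ideal_add].
Qed.
Lemma ideal_eqmod a b : J (a - b) -> J b -> J a.
Proof. by move=> Jab Jb; rewrite -(subrK b a); apply: ideal_add. Qed.

Lemma ideal_add_principal x :
  ideal_pred (fun a => exists u, J (a - u * x)).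
Proof.
split.
- by exists 0; rewrite mul0r subr0; apply: ideal_zero.
- move=> a b [u Ju] [v Jv]; exists (u + v).
  by rewrite mulrDl opprD addrACA; apply: ideal_add.
- move=> a b [u Ju]; exists (a * u).
  by rewrite -mulrA -mulrBr; apply: ideal_mull.
Qed.
End IdealPred.

Section Nullstellensatz.
Variables (K : closedFieldType) (m : nat).
Hypothesis K_uncountable : forall e : K -> nat,
  exists j, forall s : seq K, exists2 x, x \notin s & e x = j.
Local Notation A := {mpoly K[m]}.

(** The polynomials of bounded degree form a finite-dimensional space. *)
Lemma dependent_of_bounded_size d N (u : 'I_N -> A) :
  (#|{: 'X_{1..m < d}}| < N)%N -> (forall j, (msize (u j) <= d)%N) ->
  exists2 c : 'I_N -> K, \sum_j c j *: u j = 0 & exists j, c j != 0.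
Proof.
move=> ltN szu.
pose U : 'M[K]_(N, #|{: 'X_{1..m < d}}|) :=
  \matrix_(j, k) (u j)@_(enum_val k : 'X_{1..m < d}).
have /rowV0Pn[c /sub_kermxP cU /rV0Pn[j cj]] : kermx U != 0.
  rewrite kermx_eq0 -row_leq_rank -ltnNge.
  by apply: leq_ltn_trans ltN; rewrite rank_leq_col.
exists (c 0); last by exists j.
apply/mpolyP => mm; rewrite mcoeff0 raddf_sum /=.
transitivity (\sum_k c 0 k * (u k)@_mm); first by apply: eq_bigr => k _; rewrite mcoeffZ.
have [lt|le] := ltnP (mdeg mm) d.
  have /matrixP/(_ 0 (enum_rank (BMultinom lt))) := cU.
  rewrite mxE [RHS]mxE => sum0; rewrite -[RHS]sum0.
  by apply: eq_bigr => k _; rewrite mxE enum_rankK.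
rewrite big1 // => k _; rewrite memN_msupp_eq0 ?mulr0 //.
by apply: msize_mdeg_ge; apply: leq_trans le.
Qed.

(** If [J] contains no power of [f], one coordinate can be specialized without
losing this.  Otherwise, modulo [J], each ['X_i - a] divides a power of [f].  As
[K] is uncountable, infinitely many [a] share the exponent and a bound on the
degree of the cofactor.  Finitely many of these cofactors are linearly
dependent, and clearing denominators puts [f ^+ k * p('X_i)] in [J] for some
nonzero [p] in one variable.  This [p] splits, and each of its linear factors
divides a power of [f], so a power of [f] is in [J]. *)
Lemma avoid_power_step (J : A -> Prop) (f : A) (i : 'I_m) :
  ideal_pred J -> (forall k, ~ J (f ^+ k)) ->
  exists a : K, forall k, ~ exists u, J (f ^+ k - u * ('X_i - a%:A)).
Proof.
move=> idJ nJ; apply: contrapT => noa.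
have /choice[v vP] : forall a : K, exists ku : nat * A,
    J (f ^+ ku.1 - ku.2 * ('X_i - a%:A)).
  move=> a; apply: contrapT => nk; apply: noa; exists a => k [u Ju].
  by apply: nk; exists (k, u).
pose e x := pickle ((v x).1, msize (v x).2).
have [j0 jP] := K_uncountable e.
have [x0 _ ex0] := jP [::].
pose k := (v x0).1; pose d := msize (v x0).2.
have big N : exists s : seq K, [/\ uniq s, size s = N &
    all (fun x => ((v x).1 == k) && (msize (v x).2 == d)) s].
  elim: N => [|N [s [us szs alls]]]; first by exists [::].
  have [x xs ex] := jP s.
  exists (x :: s); rewrite /= xs us szs alls andbT; split=> //.
  move: ex; rewrite -ex0 => /(pcan_inj pickleK)[-> ->].
  by rewrite !eqxx.
have [s [us szs /allP sP]] := big #|{: 'X_{1..m < d}}|.+1.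
set N := _.+1 in szs.
pose al (j : 'I_N) : K := s`_j.
have al_inj : injective al.
  move=> j l /eqP; rewrite nth_uniq ?szs ?ltn_ord // => /eqP.
  exact: val_inj.
pose u j := (v (al j)).2.
have uP j : J (f ^+ k - u j * ('X_i - (al j)%:A)) /\ msize (u j) = d.
  have /sP/andP[/eqP <- /eqP <-] : s`_j \in s by rewrite mem_nth ?szs.
  by split=> //; apply: vP.
have [c cu [j cj]] := @dependent_of_bounded_size d N u (ltnSn _)
  (fun j => eq_leq (proj2 (uP j))).
pose ev : {poly K} -> A := horner_alg 'X_i.
have evB z : ev ('X - z%:P) = 'X_i - z%:A.
  by rewrite /ev rmorphB /= horner_algX horner_algC.
have ev_prod (I : Type) (r : seq I) (P : pred I) (F : I -> K) :
    horner_alg 'X_i (\prod_(z <- r | P z) ('X - (F z)%:P)) =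
    \prod_(z <- r | P z) ('X_i - (F z)%:A) :> A.
  by rewrite rmorph_prod; apply: eq_bigr => z _; apply: evB.
(* the numerator of the linear combination of the 1 / ('X - al j) *)
pose p : {poly K} := \sum_j c j *: \prod_(l | l != j) ('X - (al l)%:P).
have p0 : p != 0.
  apply/eqP => /(congr1 (fun q : {poly K} => q.[al j])).
  rewrite horner0 horner_sum (bigD1 j) //= hornerZ horner_prod.
  rewrite [X in _ + X]big1 ?addr0 => [|l lj]; last first.
    rewrite hornerZ horner_prod (bigD1 j) 1?eq_sym //= !hornerE subrr.
    by rewrite /= mulr0 mul0r.
  move/eqP; rewrite mulf_eq0 (negPf cj) /= => /prodf_eq0[l lj].
  by rewrite !hornerE subr_eq0 => /eqP/al_inj jl; rewrite jl eqxx in lj.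
have Jp : J (f ^+ k * ev p).
  rewrite /ev rmorph_sum /= mulr_sumr.
  pose Q := \prod_l ('X_i - (al l)%:A) : A.
  have Q0 : \sum_j c j *: (u j * Q) = 0.
    by under eq_bigr do rewrite scalerAl; rewrite -mulr_suml cu mul0r.
  rewrite -[X in J X]subr0 -[X in _ - X]Q0 -sumrB; apply: ideal_sum => // l _.
  rewrite linearZ /= mulr_algl -scalerAr -scalerBr -mulr_algl; apply: ideal_mull => //.
  have -> : Q = ('X_i - (al l)%:A) * \prod_(k | k != l) ('X_i - (al k)%:A).
    by rewrite /Q (bigD1 l).
  rewrite ev_prod mulrA.
  by rewrite -mulrBl; apply: ideal_mulr => //; case: (uP l).
have clear_roots (r : seq K) : forall g,
    J (g * \prod_(z <- r) ('X_i - z%:A)) -> exists l, J (f ^+ l * g).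
  elim: r => [|z r IH] g; first by rewrite big_nil mulr1 => Jg; exists 0; rewrite mul1r.
  rewrite big_cons mulrA => /IH[l Jl]; exists (l + (v z).1)%N.
  apply: (ideal_eqmod idJ (b := (v z).2 * (f ^+ l * (g * ('X_i - z%:A))))); last exact: ideal_mull.
  set w := (X in J X).
  suff -> : w = f ^+ l * g * (f ^+ (v z).1 - (v z).2 * ('X_i - z%:A)).
    by apply: ideal_mull.
  by rewrite /w exprD; ring.
have [r pr] := closed_field_poly_normal p.
have evp : ev p = lead_coef p *: \prod_(z <- r) ('X_i - z%:A).
  by rewrite [in LHS]pr /ev linearZ /= mulr_algl ev_prod.
have : exists l, J (f ^+ l * f ^+ k).
  apply: (clear_roots r); rewrite -[X in J X]scale1r.
  have lc0 : lead_coef p != 0 by rewrite lead_coef_eq0.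
  rewrite -(mulVf lc0) -scalerA scalerAr -evp -mulr_algl.
  exact: ideal_mull.
by case=> l; rewrite -exprD; apply: nJ.
Qed.

(** Specializing the coordinates one by one gives an ideal modulo which every
polynomial is congruent to its value at a point [a]. *)
Lemma avoid_power_point (J : A -> Prop) (f : A) :
  ideal_pred J -> (forall k, ~ J (f ^+ k)) ->
  exists2 a : 'I_m -> K, forall p, J p -> p.@[a] = 0 & f.@[a] != 0.
Proof.
move=> idJ nJ.
have coord (s : seq 'I_m) : exists J' : A -> Prop,
   [/\ ideal_pred J', forall k, ~ J' (f ^+ k), forall p, J p -> J' p &
       forall i, i \in s -> exists a : K, J' ('X_i - a%:A)].
  elim: s => [|i s [J' [idJ' nJ' JJ' sJ']]]; first by exists J.
  have [a aP] := avoid_power_step i idJ' nJ'.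
  exists (fun p => exists u, J' (p - u * ('X_i - a%:A))); split=> //.
  - exact: ideal_add_principal.
  - by move=> p Jp; exists 0; rewrite mul0r subr0; apply: JJ'.
  - move=> l; rewrite inE => /orP[/eqP ->|/sJ'[b Jb]].
      by exists a, 1; rewrite mul1r subrr; apply: ideal_zero.
    by exists b, 0; rewrite mul0r subr0.
have [J' [idJ' nJ' JJ' sJ']] := coord (enum 'I_m).
have /choice[a aP] : forall i, exists a : K, J' ('X_i - a%:A).
  by move=> i; apply: sJ'; rewrite mem_enum.
have mod_point p : J' (p - (p.@[a])%:A).
  have sub_prod q q' : J' (q - (q.@[a])%:A) -> J' (q' - (q'.@[a])%:A) ->
      J' (q * q' - ((q * q').@[a])%:A).
    move=> Jq Jq'; rewrite mevalM.
    have -> : q * q' - (q.@[a] * q'.@[a])%:A =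
      q' * (q - q.@[a]%:A) + (q.@[a])%:A * (q' - (q'.@[a])%:A).
      by rewrite -scalerA -[_ *: (_ *: 1)]mulr_algl; ring.
    by apply: ideal_add => //; apply: ideal_mull.
  have const1 : J' (1 - ((1 : A).@[a])%:A).
    by rewrite meval1 scale1r subrr; apply: ideal_zero.
  rewrite [in X in J' X](mpolyE p) raddf_sum /= scaler_suml -sumrB.
  apply: ideal_sum => // mm _.
  rewrite mevalZ -scalerA -scalerBr -[_ *: (_ - _)]mulr_algl; apply: (ideal_mull idJ').
  rewrite mpolyXE_id.
  apply: (big_ind (fun q : A => J' (q - (q.@[a])%:A))) => // i _.
  elim: (mm i) => [|l IH]; first by rewrite expr0.
  by rewrite exprS; apply: sub_prod => //; rewrite mevalXU.
exists a.
- move=> p Jp; apply/eqP/contraT => pa; exfalso.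
  apply: (nJ' 0%N); rewrite expr0 -[X in J' X]scale1r -(mulVf pa) -scalerA.
  rewrite -mulr_algl; apply: ideal_mull => //.
  by rewrite -[X in J' X](subKr p); apply: ideal_sub => //; apply: JJ'.
- apply/eqP => fa; apply: (nJ' 1%N); rewrite expr1.
  by have := mod_point f; rewrite fa scale0r subr0.
Qed.

Lemma nullstellensatz (J : A -> Prop) (f : A) : ideal_pred J ->
  (forall a : 'I_m -> K, (forall p, J p -> p.@[a] = 0) -> f.@[a] = 0) ->
  exists k, J (f ^+ k).
Proof.
move=> idJ van; apply: contrapT => nJ.
have [k Jk|a Ja /eqP[]] := avoid_power_point idJ (f := f).
  by apply: nJ; exists k.
exact: van.
Qed.
End Nullstellensatz.

(** * Normal forms modulo polynomials with leading monomials powers of the variables *)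
Definition generated (A : comNzRingType) (k : nat) (F : 'I_k -> A) (a : A) : Prop :=
  exists c : 'I_k -> A, a = \sum_i c i * F i.

Section Generated.
Variables (A : comNzRingType) (k : nat) (F : 'I_k -> A).

Lemma generated_ideal : ideal_pred (generated F).
Proof.
split.
- by exists (fun=> 0); rewrite big1 // => i _; rewrite mul0r.
- move=> _ _ [c ->] [d ->]; exists (fun i => c i + d i).
  by rewrite -big_split; apply: eq_bigr => i _; rewrite mulrDl.
- move=> a _ [c ->]; exists (fun i => a * c i).
  by rewrite mulr_sumr; apply: eq_bigr => i _; rewrite mulrA.
Qed.

Lemma generated_gen i : generated F (F i).
Proof.
exists (fun j => (j == i)%:R); rewrite (bigD1 i) //= eqxx mul1r big1 ?addr0 //.
by move=> j /negPf ->; rewrite mul0r.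
Qed.

Lemma generated_sub (J : A -> Prop) :
  ideal_pred J -> (forall i, J (F i)) -> forall a, generated F a -> J a.
Proof.
move=> idJ JF _ [c ->]; apply: (ideal_sum idJ) => i _; exact: (ideal_mull idJ).
Qed.
End Generated.

Section NormalForms.
Variables (A : idomainType) (n : nat).
Variables (H : 'I_n -> {mpoly A[n]}) (d : 'I_n -> nat).
Hypothesis d_gt0 : forall k, (0 < d k)%N.
Hypothesis mlead_H : forall k, mlead (H k) = (U_(k) *+ d k)%MM.
Hypothesis mleadc_H : forall k, (H k)@_(mlead (H k)) \is a GRing.unit.

Definition reduced (p : {mpoly A[n]}) : Prop :=
  forall m k, m \in msupp p -> (m k < d k)%N.

Let quo (m : 'X_{1..n}) k : nat := (m k %/ d k)%N.
Let rem (m : 'X_{1..n}) : 'X_{1..n} := [multinom (m k %% d k)%N | k < n].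

(** Digitwise division of the exponents by [d]: the [H]-adic analogue of ['X_[m]].
Its leading monomial is again [m], by [mlead_adic]. *)
Definition adic_monomial (m : 'X_{1..n}) : {mpoly A[n]} :=
  (\prod_k H k ^+ quo m k) * 'X_[rem m].

Lemma H_neq0 k : H k != 0.
Proof.
apply/eqP => H0; have := mleadc_H k.
by rewrite H0 mcoeff0 unitr0.
Qed.

Lemma mlead_adic m : mlead (adic_monomial m) = m.
Proof.
have prodH0 : \prod_k H k ^+ quo m k != 0.
  by apply/prodf_neq0 => k _; rewrite expf_neq0 ?H_neq0.
rewrite mleadM //; last by rewrite -mleadc_eq0 mleadXm mcoeffX eqxx oner_eq0.
rewrite mleadXm mlead_prod; last by move=> k _ _; rewrite expf_neq0 ?H_neq0.
apply/mnmP => i; rewrite mnmDE mnm_sumE mnmE (bigD1 i) //= big1 => [|k ki].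
  rewrite mleadX ?H_neq0 // mlead_H !mulmnE mnm1E eqxx addn0 mul1n mulnC.
  by rewrite -divn_eq.
by rewrite mleadX ?H_neq0 // mlead_H !mulmnE mnm1E (negPf ki).
Qed.

Lemma mleadc_adic m : (adic_monomial m)@_m \is a GRing.unit.
Proof.
suff: (adic_monomial m)@_(mlead (adic_monomial m)) \is a GRing.unit.
  by rewrite mlead_adic.
rewrite /adic_monomial.
have -> : forall p q : {mpoly A[n]}, p != 0 -> q != 0 ->
    (p * q)@_(mlead (p * q)) = p@_(mlead p) * q@_(mlead q).
  by move=> p q p0 q0; rewrite mleadM // mleadcM.
- rewrite mleadXm mcoeffX eqxx mulr1.
  apply: (big_ind (fun p : {mpoly A[n]} => p@_(mlead p) \is a GRing.unit)).
  + by rewrite mlead1 mcoeff1 eqxx unitr1.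
  + move=> p q up uq; rewrite mleadM ?mleadcM ?unitrM ?up //.
      by apply: contraTneq up => ->; rewrite mcoeff0 unitr0.
    by apply: contraTneq uq => ->; rewrite mcoeff0 unitr0.
  + by move=> k _; rewrite mleadX ?H_neq0 // mleadcX unitrX ?mleadc_H.
- by apply/prodf_neq0 => k _; rewrite expf_neq0 ?H_neq0.
- by rewrite -mleadc_eq0 mleadXm mcoeffX eqxx oner_eq0.
Qed.

(** Adding [d k] to the exponent of ['X_k] increases the corresponding quotient by
one and leaves the remainders alone. *)
Lemma adic_mulH k m : H k * adic_monomial m = adic_monomial (U_(k) *+ d k + m)%MM.
Proof.
rewrite /adic_monomial mulrA; congr (_ * 'X_[_]).
  rewrite (bigD1 k) //= [RHS](bigD1 k) //= mulrA -exprS; congr (_ * _).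
    congr (_ ^+ _); rewrite /quo mnmDE mulmnE mnm1E eqxx mul1n.
    by rewrite divnDl // divnn d_gt0.
  apply: eq_bigr => i ik; congr (_ ^+ _); rewrite /quo mnmDE mulmnE mnm1E.
  by rewrite eq_sym (negPf ik).
apply/mnmP => i; rewrite !mnmE mulmnE mnm1E.
by have [<-|_] := eqVneq k i; rewrite ?mul1n ?modnDl.
Qed.

Lemma adic_reduced (m : 'X_{1..n}) : (forall k, (m k < d k)%N) -> adic_monomial m = 'X_[m].
Proof.
move=> mlt; rewrite /adic_monomial big1 ?mul1r.
  by congr 'X_[_]; apply/mnmP => k; rewrite mnmE modn_small.
by move=> k _; rewrite /quo divn_small.
Qed.

(** Replacing each monomial by its [H]-adic analogue is a linear bijection, being
triangular for the monomial order.  It turns multiplication by a power of a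
variable into multiplication by some [H k], so that membership in the ideal
generated by the [H k] becomes membership in a monomial ideal. *)
Definition adic (p : {mpoly A[n]}) : {mpoly A[n]} :=
  \sum_(m <- msupp p) p@_m *: adic_monomial m.

Lemma adicwE b p : (msize p <= b)%N ->
  adic p = \sum_(m : 'X_{1..n < b}) p@_m *: adic_monomial m.
Proof.
move=> leb; pose I : subFinType _ := 'X_{1..n < b}.
rewrite /adic (big_mksub I) //=; first last.
+ by move=> x /msize_mdeg_lt /leq_trans ->.
+ by rewrite msupp_uniq.
rewrite big_rmcond //= => m; rewrite -mcoeff_eq0 => /eqP ->.
by rewrite scale0r.
Qed.

Lemma adicD p q : adic (p + q) = adic p + adic q.
Proof.
set b := maxn (msize p) (msize q).
have pb : (msize p <= b)%N by rewrite leq_maxl.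
have qb : (msize q <= b)%N by rewrite leq_maxr.
rewrite (adicwE pb) (adicwE qb) (adicwE (msizeD_le p q)).
rewrite -big_split; apply: eq_bigr => m _ /=.
by rewrite mcoeffD scalerDl.
Qed.

Lemma adicZ c p : adic (c *: p) = c *: adic p.
Proof.
rewrite (adicwE (msizeZ_le p c)) (adicwE (leqnn _)).
by rewrite scaler_sumr; apply: eq_bigr => m _; rewrite mcoeffZ scalerA.
Qed.

Lemma adic0 : adic 0 = 0.
Proof. by rewrite -[X in adic X](scale0r 0) adicZ scale0r. Qed.

Lemma adic_sum (I : Type) (r : seq I) P (F : I -> {mpoly A[n]}) :
  adic (\sum_(i <- r | P i) F i) = \sum_(i <- r | P i) adic (F i).
Proof. exact: (big_morph adic adicD adic0). Qed.

Lemma adicX m : adic 'X_[m] = adic_monomial m.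
Proof. by rewrite /adic msuppX big_seq1 mcoeffX eqxx scale1r. Qed.

Lemma adic_mulHl k p : H k * adic p = adic ('X_[(U_(k) *+ d k)%MM] * p).
Proof.
rewrite [in RHS](mpolyE p) [in RHS]mulr_sumr adic_sum [adic p]/adic mulr_sumr.
apply: eq_bigr => m _; rewrite -!scalerAr -mpolyXD adicZ adicX.
by rewrite adic_mulH.
Qed.

Lemma adic_id p : reduced p -> adic p = p.
Proof.
move=> redp; rewrite {2}(mpolyE p) /adic !big_seq.
by apply: eq_bigr => m mp; rewrite adic_reduced // => k; apply: redp.
Qed.

Lemma adic_inj0 p : adic p = 0 -> p = 0.
Proof.
move=> /(congr1 (mcoeff (mlead p))); rewrite mcoeff0 raddf_sum /= => sum0.
apply/eqP; rewrite -mleadc_eq0; apply/eqP.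
have [->|p0] := eqVneq p 0; first by rewrite mcoeff0.
move: sum0; rewrite (bigD1_seq (mlead p)) ?mlead_supp ?msupp_uniq //=.
rewrite big_seq_cond big1 => [|m /andP[mp mneq]]; last first.
  rewrite mcoeffZ [X in _ * X]mcoeff_gt_mlead ?mulr0 // mlead_adic.
  by rewrite lt_neqAle mneq msupp_le_mlead.
rewrite addr0 mcoeffZ => /eqP; rewrite mulf_eq0 => /orP[/eqP //|/eqP u0].
by have := mleadc_adic (mlead p); rewrite u0 unitr0.
Qed.

Lemma adic_surj f : exists p, f = adic p.
Proof.
elim/mleadrect: f => f IH.
have [->|f0] := eqVneq f 0; first by exists 0; rewrite adic0.
set m := mlead f.
pose c := f@_m / (adic_monomial m)@_m.
pose g := f - c *: adic_monomial m.
have gm : g@_m = 0 by rewrite mcoeffB mcoeffZ divrK ?subrr ?mleadc_adic.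
have [g0|g0] := eqVneq g 0.
  by exists (c *: 'X_[m]); rewrite adicZ adicX; apply/eqP; rewrite -subr_eq0 -/g g0.
have /IH[p gp] : (mlead g < m)%O.
  rewrite lt_neqAle; apply/andP; split.
    by apply: contra_neq g0 => gm'; apply/eqP; rewrite -mleadc_eq0 gm' gm.
  apply: (le_trans (mleadB_le _ _)); rewrite leUx lexx /=.
  by apply: le_trans (mleadZ_le _ _) _; rewrite mlead_adic.
by exists (p + c *: 'X_[m]); rewrite adicD adicZ adicX -gp subrK.
Qed.

Lemma normal_form f : exists2 p, reduced p & generated H (f - p).
Proof.
have [q ->] := adic_surj f.
exists (\sum_(m <- msupp q | [forall k, (m k < d k)%N]) q@_m *: 'X_[m]).
  move=> m k; apply: contraTT => nlt.
  rewrite -mcoeff_eq0 raddf_sum /= big1 // => m' /forallP/(_ k) ltm.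
  rewrite mcoeffZ mcoeffX; case: eqP ltm => [->|_ _]; last by rewrite mulr0.
  by rewrite (negPf nlt).
rewrite /adic (bigID (fun m : 'X_{1..n} => [forall k, (m k < d k)%N])) /=.
rewrite addrAC -sumrB [X in X + _]big1 ?add0r.
  apply: (ideal_sum (generated_ideal H)) => m /forallPn[k]; rewrite -leqNgt => dk.
  have le : ((U_(k) *+ d k)%MM <= m)%MM.
    apply/mnm_lepP => i; rewrite mulmnE mnm1E.
    by have [<-|_] := eqVneq k i; rewrite ?mul1n.
  rewrite -(submK le) addmC -adic_mulH scalerAr mulrC.
  exact: ideal_mull (generated_ideal H) _ _ (generated_gen H k).
by move=> m /forallP mlt; rewrite adic_reduced // subrr.
Qed.

(** Through [adic], a combination of the [H k] is the image of a combination of the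
powers ['X_k ^+ d k], whereas a reduced polynomial is its own image.  By
injectivity the two preimages agree, and they have no monomial in common. *)
Lemma reduced_ideal_eq0 f : reduced f -> generated H f -> f = 0.
Proof.
move=> redf [c fE].
have /choice[p cp] k := adic_surj (c k).
pose q := \sum_k 'X_[(U_(k) *+ d k)%MM] * p k.
have : f = q.
  apply/eqP; rewrite -subr_eq0; apply/eqP/adic_inj0.
  rewrite -scaleN1r adicD adicZ scaleN1r adic_id // /q adic_sum fE.
  by rewrite -sumrB big1 // => k _; rewrite cp mulrC adic_mulHl subrr.
move=> fq; apply/mpolyP => m; rewrite mcoeff0.
apply/eqP; rewrite mcoeff_eq0; apply/negP => mf.
move: (mf); rewrite mcoeff_msupp fq /q raddf_sum /= => /eqP; apply.
apply: big1 => k _; apply/eqP; rewrite mcoeff_eq0; apply/negP.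
rewrite mulrC (perm_mem (msuppMX _ _)) => /mapP[m' _ mE].
have := redf m k mf; rewrite mE mnmDE mulmnE mnm1E eqxx mul1n.
by rewrite ltnNge leq_addr.
Qed.
End NormalForms.

(** * Last rows of powers of a Hessenberg matrix *)
Section HessMatrix.
Variable n' : nat.
Local Notation n := n'.+1.

(** The matrix [M_n] with arbitrary entries in a ring; only the values of [q] above
the diagonal matter. *)
Definition hess_mx (T : comNzRingType) (x : 'I_n -> T) (q : 'I_n -> 'I_n -> T) : 'M[T]_n :=
  \matrix_(r, s)
    if r == s then x r else if r == s.+1 :> nat then -1
    else if (r < s)%N then q r s else 0.

Lemma map_hess_mx (T U : comNzRingType) (f : {rmorphism T -> U}) x q :
  map_mx f (hess_mx x q) = hess_mx (f \o x) (fun r s => f (q r s)).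
Proof.
apply/matrixP => r s; rewrite !mxE.
by case: ifP => // _; case: ifP => [_|_]; [rewrite rmorphN1|case: ifP; rewrite ?rmorph0].
Qed.

(** The last basis row vector times [M ^+ n].  For a Hessenberg matrix this vector
is cyclic, so these [n] entries express nilpotency. *)
Definition last_row_pow (T : comNzRingType) (M : 'M[T]_n) (k : 'I_n) : T :=
  (M ^+ n) ord_max k.

Lemma map_last_row_pow (T U : comNzRingType) (f : {rmorphism T -> U}) M k :
  f (last_row_pow M k) = last_row_pow (map_mx f M) k.
Proof. by rewrite /last_row_pow -(rmorphXn (map_mx f)) mxE. Qed.

Section Generators.
Variables (T : comNzRingType) (x : 'I_n -> T) (q : 'I_n -> 'I_n -> T).
Let M := hess_mx x q.

(** Each multiplication by a Hessenberg matrix moves the last basis vector at most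
one column to the left, picking up the sign of the subdiagonal. *)
Lemma hess_mx_pow_last m (k : 'I_n) : (m + k <= n')%N ->
  (M ^+ m) ord_max k = if (m + k == n')%N then (-1) ^+ m else 0.
Proof.
elim: m k => [|m IH] k mk.
  by rewrite expr0 mxE add0n eq_sym -val_eqE /=; case: eqP.
rewrite exprSr mxE.
have kn : (k.+1 < n)%N by lia.
rewrite (bigD1 (Ordinal kn)) //= big1 => [|j jk].
  rewrite addr0 IH /= -?addSnnS //; have -> : M (Ordinal kn) k = -1.
    by rewrite mxE -val_eqE /= eqxx; case: eqP => //; lia.
  by case: ifP; rewrite ?mul0r // exprSr.
have [jk'|kj] := leqP j k.
  by rewrite IH ?ifF ?mul0r //; lia.
rewrite [M j k]mxE; case: eqP => [jk'|_]; first by rewrite jk' ltnn in kj.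
case: eqP => [jk'|_]; first by move: jk; rewrite -val_eqE /= jk' eqxx.
by rewrite ltnNge ltnW ?mulr0.
Qed.
End Generators.

Section SameIdeal.
Variables (T : comUnitRingType) (x : 'I_n -> T) (q : 'I_n -> 'I_n -> T).
Let M := hess_mx x q.
Let G : 'M[T]_n := \matrix_(j, k) (M ^+ j) ord_max (rev_ord k).

Lemma last_rows_unitmx : G \in unitmx.
Proof.
have rev_le (i j : 'I_n) : (i <= j)%N -> (i + rev_ord j <= n')%N.
  by move=> ij; have := ltn_ord j; rewrite /=; lia.
rewrite unitmxE det_trig; last first.
  apply/is_trig_mxP => i j ij; rewrite mxE hess_mx_pow_last ?rev_le //; last exact: ltnW.
  by rewrite ifF //=; have := ltn_ord j; lia.
elim/big_ind: _ => [|a b ua ub|i _]; rewrite ?unitr1 ?unitrM ?ua ?ub //.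
rewrite mxE hess_mx_pow_last ?rev_le //.
by rewrite ifT ?unitrX ?unitrN1 //=; have := ltn_ord i; lia.
Qed.

Let c : 'rV[T]_n := \row_j (char_poly M)`_j.

(** The last row of the Cayley-Hamilton identity. *)
Lemma char_poly_last_rows : c *m G = \row_k - last_row_pow M (rev_ord k).
Proof.
have : horner_mx M (char_poly M) = 0 by apply: Cayley_Hamilton.
rewrite -[X in horner_mx M X]coefK poly_def size_char_poly big_ord_recr /=.
rewrite raddfD raddf_sum /= -[X in _ + X]/(horner_mx M _) => CH.
apply/rowP => k; rewrite !mxE.
have /matrixP/(_ ord_max (rev_ord k)) := CH.
have -> : (char_poly M)`_n = 1.
  by have /monicP := char_poly_monic M; rewrite lead_coefE size_char_poly.
rewrite scale1r rmorphXn /= horner_mx_X mxE [RHS]mxE summxE => /eqP.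
rewrite addr_eq0 => /eqP <-; apply: eq_bigr => j _.
by rewrite !mxE linearZ /= rmorphXn /= horner_mx_X mxE.
Qed.

(** The two families of generators differ by an invertible matrix, the one whose
rows are the successive images of the cyclic vector. *)
Lemma generated_last_row_pow a :
  generated (last_row_pow M) a <-> generated (fun j : 'I_n => (char_poly M)`_j) a.
Proof.
split; apply: generated_sub; try exact: generated_ideal; move=> k.
- have /rowP/(_ (rev_ord k)) := char_poly_last_rows.
  rewrite !mxE rev_ordK => /eqP; rewrite eq_sym eqr_oppLR => /eqP ->.
  apply: (ideal_opp (generated_ideal _)); apply: (ideal_sum (generated_ideal _)) => j _.
  rewrite mxE; apply: (ideal_mulr (generated_ideal _)).
  exact: (generated_gen (fun j : 'I_n => (char_poly M)`_j)).
- have /rowP/(_ k) : c = (\row_k - last_row_pow M (rev_ord k)) *m invmx G.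
    by rewrite -char_poly_last_rows mulmxK // last_rows_unitmx.
  rewrite !mxE => ->; apply: (ideal_sum (generated_ideal _)) => j _.
  rewrite mxE; apply: (ideal_mulr (generated_ideal _)).
  by apply: (ideal_opp (generated_ideal _)); apply: generated_gen.
Qed.
End SameIdeal.

Section Leading.
Variables (A : idomainType).
Implicit Types (p : {mpoly A[n]}) (u v : 'X_{1..n}).

(** Up to the order of monomials, [a X^u] is the largest term that [p] may have; [a]
is allowed to vanish, so that these estimates can be added. *)
Definition lead_at p u (a : A) : Prop := (mlead p <= u)%O /\ p@_u = a.

Lemma lead_atD p p' u a a' : lead_at p u a -> lead_at p' u a' -> lead_at (p + p') u (a + a').
Proof.
move=> [lep pu] [lep' pu']; split; last by rewrite mcoeffD pu pu'.
by apply: le_trans (mleadD_le _ _) _; rewrite leUx lep.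
Qed.

Lemma lead_at0 u : lead_at 0 u 0.
Proof. by split; rewrite ?mcoeff0 // mlead0 le0x. Qed.

Lemma lead_at_sum (I : finType) (F : I -> {mpoly A[n]}) (a : I -> A) u :
  (forall i, lead_at (F i) u (a i)) -> lead_at (\sum_i F i) u (\sum_i a i).
Proof.
move=> Ft; elim/big_ind2: _ => //; first exact: lead_at0.
by move=> p a1 p' a2; apply: lead_atD.
Qed.

Lemma lead_atM p p' u u' a a' : lead_at p u a -> lead_at p' u' a' ->
  lead_at (p * p') (u + u')%MM (a * a').
Proof.
move=> [lep pu] [lep' pu']; split; last by rewrite mleadcMW // pu pu'.
by apply: le_trans (mleadM_le _ _) (lem_add _ _).
Qed.

Lemma lead_atC (a : A) : lead_at a%:MP 0%MM a.
Proof. by split; rewrite ?mleadC ?mcoeffC ?eqxx ?mulr1. Qed.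

Lemma lead_at_lt p u v a : lead_at p u a -> (u < v)%O -> lead_at p v 0.
Proof.
move=> [lep _] uv; have lt := le_lt_trans lep uv.
by split; rewrite ?mcoeff_gt_mlead // ltW.
Qed.

Variable q : 'I_n -> 'I_n -> A.

Definition generic_mx : 'M[{mpoly A[n]}]_n :=
  hess_mx (fun i => 'X_i) (fun r s => (q r s)%:MP).

Lemma lt_mnm_powU (j k : 'I_n) e : (j < k)%N -> (0 < e)%N ->
  ((U_(k) *+ e)%MM < (U_(j) *+ e)%MM)%O.
Proof.
move=> jk e0; apply/ltmcP; first by rewrite !mdegMn !mdeg1.
exists j => [i ij|]; rewrite !mulmnE !mnm1E.
  by rewrite -!val_eqE /= !gtn_eqF // (ltn_trans ij).
by rewrite eqxx -val_eqE /= gtn_eqF // mul1n.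
Qed.

(** In the recursion from [M ^+ m] to [M ^+ m.+1], the part of highest degree of
entry [k] is a polynomial in ['X_k], ['X_(k+1)], ..., in which ['X_k] is the
largest variable; the parameters [q] only meet terms of lower degree.  So the
leading term is a power of ['X_k]. *)
Lemma generic_mx_pow_last m (k : 'I_n) : (n' <= m + k)%N ->
  lead_at ((generic_mx ^+ m) ord_max k) (U_(k) *+ (m + k - n'))%MM ((-1) ^+ (n' - k)).
Proof.
elim: m k => [|m IH] k mk.
  have -> : k = ord_max by apply/val_inj => /=; have := ltn_ord k; lia.
  by rewrite add0n /= !subnn expr0 mxE eqxx; apply: lead_atC.
have low (j : 'I_n) : (m + j < n')%N -> (generic_mx ^+ m) ord_max j = 0.
  by move=> mj; rewrite hess_mx_pow_last ?ifF //; lia.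
rewrite exprSr mxE.
set e := (m.+1 + k - n')%N.
(* Only one summand reaches the monomial 'X_k ^+ e: the diagonal one, unless
   e = 0, where the path has just arrived in column k by the subdiagonal. *)
pose j0 : nat := if e == 0%N then k.+1 else k.
have j0n : (j0 < n)%N by rewrite /j0; case: ifP => e0; have := ltn_ord k; lia.
have -> : (-1) ^+ (n' - k) =
    \sum_(j < n) (if j == Ordinal j0n then (-1) ^+ (n' - k) else 0) :> A.
  by rewrite -big_mkcond big_pred1_eq.
apply: lead_at_sum => j.
rewrite [generic_mx j k]mxE; have [->|jk] := eqVneq j k.
  have [mk'|mk'] := ltnP (m + k) n'.
    rewrite low // mul0r -val_eqE /= /j0.
    have -> : (e == 0)%N by lia.
    by rewrite ltn_eqF //; exact: lead_at0.
  rewrite -val_eqE /= /j0; have -> : (e == 0)%N = false by apply/eqP; lia.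
  rewrite eqxx; have -> : (U_(k) *+ e = U_(k) *+ (m + k - n') + U_(k))%MM.
    by rewrite -mulmSr; congr (_ *+ _)%MM; lia.
  rewrite -[X in lead_at _ _ X]mulr1; apply: lead_atM; first exact: IH.
  by split; rewrite ?mleadXm ?mcoeffX ?eqxx.
case: eqP => [jk'|jk'].
  have IHj := IH j; rewrite jk' in IHj.
  have {}IHj := IHj ltac:(lia).
  have -> : (-1 : {mpoly A[n]}) = (-1)%:MP by rewrite mpolyCN mpolyC1.
  have tj : lead_at ((generic_mx ^+ m) ord_max j * (-1)%:MP) (U_(j) *+ e)%MM ((-1) ^+ (n' - k)).
    rewrite -[(U_(j) *+ e)%MM]addm0.
    have -> : (-1) ^+ (n' - k) = (-1) ^+ (n' - k.+1) * -1 :> A.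
      by rewrite -exprSr; congr (_ ^+ _); have := ltn_ord j; lia.
    apply: lead_atM; last exact: lead_atC.
    by move: IHj; rewrite addnS -addSn.
  rewrite -val_eqE /= /j0; case: (eqVneq e 0%N) => e0.
    by rewrite jk' eqxx e0 mulm0n; move: tj; rewrite e0 mulm0n.
  rewrite jk' gtn_eqF //; apply: (lead_at_lt tj); apply: lt_mnm_powU; lia.
have -> : (j == Ordinal j0n) = false.
  by apply/eqP => /(congr1 val) /=; rewrite /j0; move: jk; rewrite -val_eqE /=; case: ifP => _; lia.
case: ifP => ltjk; last by rewrite mulr0; apply: lead_at0.
have [mj|mj] := ltnP (m + j) n'; first by rewrite low // mul0r; apply: lead_at0.
apply: (lead_at_lt (lead_atM (IH j mj) (lead_atC _))).
by apply: lt_mdeg_ltmc; rewrite addm0 !mdegMn !mdeg1; lia.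
Qed.

Lemma mlead_last_row_pow (k : 'I_n) : mlead (last_row_pow generic_mx k) = (U_(k) *+ k.+1)%MM.
Proof.
have [le coef] := @generic_mx_pow_last n k ltac:(lia).
have kn : (n + k - n' = k.+1)%N by lia.
rewrite kn in le coef; apply/le_anti; rewrite le /=.
apply: msupp_le_mlead; rewrite mcoeff_msupp coef.
by rewrite signr_eq0.
Qed.

Lemma mleadc_last_row_pow (k : 'I_n) :
  (last_row_pow generic_mx k)@_(mlead (last_row_pow generic_mx k)) \is a GRing.unit.
Proof.
have [_] := @generic_mx_pow_last n k ltac:(lia).
have -> : (n + k - n' = k.+1)%N by lia.
by rewrite mlead_last_row_pow => ->; rewrite unitrX ?unitrN1.
Qed.
End Leading.
End HessMatrix.

(** * Radicality passes through a one-parameter degeneration *)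
Section Radical.
Variable n' : nat.
Local Notation n := n'.+1.

Definition radical (T : comNzRingType) (J : T -> Prop) : Prop :=
  forall f j, J (f ^+ j) -> J f.

Section Torsion.
Variables (A : idomainType) (q : 'I_n -> 'I_n -> A).
Local Notation H := (last_row_pow (generic_mx q)).

Lemma last_row_normal_form f :
  exists2 p, reduced (fun k : 'I_n => k.+1) p & generated H (f - p).
Proof.
by apply: normal_form => // k; [exact: mlead_last_row_pow|exact: mleadc_last_row_pow].
Qed.

Lemma last_row_reduced_eq0 f :
  reduced (fun k : 'I_n => k.+1) f -> generated H f -> f = 0.
Proof.
by apply: reduced_ideal_eq0 => // k; [exact: mlead_last_row_pow|exact: mleadc_last_row_pow].
Qed.

(** Constants act on normal forms coefficientwise. *)
Lemma last_row_torsion_free c f : c != 0 -> generated H (c%:MP * f) -> generated H f.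
Proof.
have idH := generated_ideal H.
move=> c0 cf; have [p redp fp] := last_row_normal_form f.
suff p0 : p = 0 by rewrite p0 subr0 in fp.
have: c *: p = 0.
  apply: last_row_reduced_eq0.
    by move=> m k /msuppZ_le; apply: redp.
  rewrite -mul_mpolyC -[X in generated _ X](subKr (c%:MP * f)).
  by apply: (ideal_sub idH) => //; rewrite -mulrBr; apply: (ideal_mull idH).
by move/eqP; rewrite mscalerI (negPf c0) => /eqP.
Qed.

Lemma radical_reduced :
  (forall p j, reduced (fun k : 'I_n => k.+1) p -> generated H (p ^+ j) -> p = 0) ->
  radical (generated H).
Proof.
have idH := generated_ideal H.
move=> red0 f j fj; have [p redp fp] := last_row_normal_form f.
apply: (ideal_eqmod idH fp); rewrite (red0 p j) //; first exact: ideal_zero.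
apply: (ideal_eqmod idH _ fj); rewrite -opprB; apply: (ideal_opp idH).
by rewrite subrXX; apply: (ideal_mulr idH).
Qed.
End Torsion.

Section Specialization.
Variables (A : idomainType) (q : 'I_n -> 'I_n -> {poly A}).

(** Setting the variable of [{poly A}] to zero.  A normal form [f] which is nilpotent
modulo the ideal specializes to a nilpotent normal form, hence to zero.  So [f]
is the variable times some [g], which is again a normal form, nilpotent because
the variable is not a zero divisor, and with coefficients of smaller degree. *)
Lemma radical_specialization :
  radical (generated (last_row_pow (generic_mx (fun r s => (q r s).[0])))) ->
  radical (generated (last_row_pow (generic_mx q))).
Proof.
set q0 := fun r s => _ => rad0.
pose ev : {rmorphism {mpoly {poly A}[n]} -> {mpoly A[n]}} := map_mpoly (horner_eval 0).
have ev_coef p m : (ev p)@_m = (p@_m).[0] by rewrite mcoeff_map_mpoly.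
have evM : map_mx ev (generic_mx q) = generic_mx q0.
  rewrite map_hess_mx; congr hess_mx; apply/boolp.funext => r /=; first exact: map_mpolyX.
  by apply/boolp.funext => s; rewrite /= map_mpolyC.
have evH p : generated (last_row_pow (generic_mx q)) p ->
    generated (last_row_pow (generic_mx q0)) (ev p).
  case=> c ->; exists (ev \o c); rewrite rmorph_sum; apply: eq_bigr => k _.
  by rewrite rmorphM map_last_row_pow evM.
apply: radical_reduced => f j.
have [b] : exists b, forall m, (size f@_m <= b)%N.
  exists (\max_(m <- msupp f) size f@_m) => m.
  have [mf|mf] := boolP (m \in msupp f); first exact: leq_bigmax_seq.
  by rewrite memN_msupp_eq0 ?size_poly0.
elim: b f => [|b IH] f szf redf fj.
  apply/mpolyP => m; rewrite mcoeff0; apply/eqP.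
  by rewrite -size_poly_leq0.
have ev0 : ev f = 0.
  apply: (@last_row_reduced_eq0 _ q0).
    move=> m k; rewrite mcoeff_msupp ev_coef => fm; apply: redf.
    by rewrite mcoeff_msupp; apply: contraNneq fm => ->; rewrite horner0.
  by apply: (rad0 _ j); rewrite -rmorphXn; apply: evH.
pose g : {mpoly {poly A}[n]} := map_mpoly (drop_poly 1) f.
have gm m : g@_m = drop_poly 1 f@_m by rewrite mcoeff_map_mpoly.
have fg : f = ('X)%:MP * g.
  apply/mpolyP => m; rewrite mul_mpolyC mcoeffZ gm.
  rewrite -[LHS](poly_take_drop 1) expr1 [X in X + _](_ : _ = 0) ?add0r 1?mulrC //.
  apply/polyP => i; rewrite coef_take_poly coef0; case: ifP => //.
  by case: i => // _; rewrite -horner_coef0 -ev_coef ev0 mcoeff0.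
suff g0 : g = 0 by rewrite fg g0 mulr0.
apply: IH.
- by move=> m; rewrite gm size_drop_poly leq_subLR add1n.
- move=> m k; rewrite mcoeff_msupp gm => gm0; apply: redf.
  by rewrite mcoeff_msupp; apply: contraNneq gm0 => ->; rewrite linear0.
- apply: (@last_row_torsion_free _ _ ('X ^+ j)).
    by rewrite expf_neq0 ?polyX_eq0.
  by rewrite rmorphXn -exprMn -fg.
Qed.
End Specialization.
End Radical.

(** * Tridiagonal matrices and continuants *)
Section Continuants.
Variables (T : comNzRingType) (x q : nat -> T).

Fixpoint continuant (k : nat) : {poly T} :=
  if k is k1.+1 then
    ('X - (x k1)%:P) * continuant k1 + (if k1 is k2.+1 then q k2 *: continuant k2 else 0)
  else 1.

Lemma continuant0 : continuant 0 = 1. Proof. by []. Qed.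
Lemma continuant1 : continuant 1 = 'X - (x 0)%:P.
Proof. by rewrite /= addr0 mulr1. Qed.
Lemma continuantSS k :
  continuant k.+2 = ('X - (x k.+1)%:P) * continuant k.+1 + q k *: continuant k.
Proof. by []. Qed.
Arguments continuant : simpl never.

Lemma continuant_monic_size k : continuant k \is monic /\ size (continuant k) = k.+1.
Proof.
elim/ltn_ind: k => -[|[|k]] IH.
- by split; [exact: monic1|exact: size_poly1].
- by rewrite continuant1 monicXsubC size_XsubC.
have [m1 s1] := IH k.+1 (ltnSn _); have [m0 s0] := IH k (ltnW (ltnSn _)).
have sM : size (('X - (x k.+1)%:P) * continuant k.+1) = k.+3.
  by rewrite size_Mmonic ?polyXsubC_eq0 // size_XsubC s1.
have lt : (size (q k *: continuant k)%R < size (('X - (x k.+1)%:P) * continuant k.+1)%R)%N.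
  by rewrite sM (leq_ltn_trans (size_scale_leq _ _)) ?s0.
rewrite continuantSS; split; last by rewrite size_polyDl.
by rewrite monicE lead_coefDl // -monicE monicMl // monicXsubC.
Qed.

Lemma continuant_monic k : continuant k \is monic.
Proof. by case: (continuant_monic_size k). Qed.
Lemma size_continuant k : size (continuant k) = k.+1.
Proof. by case: (continuant_monic_size k). Qed.
Lemma continuant_lead k : (continuant k)`_k = 1.
Proof.
by have /monicP := continuant_monic k; rewrite lead_coefE size_continuant.
Qed.
Lemma continuant_coef_gt k i : (k < i)%N -> (continuant k)`_i = 0.
Proof. by move=> ki; rewrite nth_default ?size_continuant. Qed.

Definition jacobi_mx n' : 'M[T]_n'.+1 :=
  hess_mx (fun i : 'I_n'.+1 => x i)
    (fun r s : 'I_n'.+1 => if s == r.+1 :> nat then q r else 0).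

(** The row of the signed continuants is annihilated by [X - M] up to its last entry,
which is the next continuant.  Multiplying by the adjugate shows that the
continuant divides the characteristic polynomial, and both are monic of the same
degree. *)
Lemma char_poly_jacobi_mx n' : char_poly (jacobi_mx n') = continuant n'.+1.
Proof.
set n := n'.+1; set M := jacobi_mx n'.
pose v : 'rV[{poly T}]_n := \row_k ((-1) ^+ k *: continuant k).
have vM : v *m char_poly_mx M = ((-1) ^+ n' *: continuant n) *: delta_mx 0 ord_max.
  apply/rowP => k; rewrite !mxE eqxx /=.
  transitivity (\sum_(j < n) ((-1) ^+ j *: continuant j) *
     (if j == k then 'X - (x k)%:P else if j == k.+1 :> nat then 1 else
      if k == j.+1 :> nat then - (q j)%:P else 0)).
    apply: eq_bigr => j _; rewrite !mxE; congr (_ * _).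
    case: (eqVneq j k) => [->|jk]; first by rewrite mulr1n.
    rewrite mulr0n sub0r; case: eqP => [_|_]; first by rewrite polyCN opprK.
    by case: eqP => [->|_]; rewrite ?ltnSn // if_same polyC0 oppr0.
  rewrite (bigD1 k) //= eqxx.
  have -> : \sum_(j < n | j != k) ((-1) ^+ j *: continuant j) *
     (if j == k then 'X - (x k)%:P else if j == k.+1 :> nat then 1 else
      if k == j.+1 :> nat then - (q j)%:P else 0) =
     (\sum_(j < n | j == k.+1 :> nat) ((-1) ^+ j *: continuant j)) +
     (\sum_(j < n | k == j.+1 :> nat) ((-1) ^+ j *: continuant j) * - (q j)%:P).
    rewrite [X in _ = X + _]big_mkcond [X in _ = _ + X]big_mkcond -big_split.
    rewrite big_mkcond; apply: eq_bigr => j _ /=.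
    case: (eqVneq j k) => [->|jk] /=.
      by rewrite ?eqxx !ltn_eqF // addr0.
    case: (eqVneq (j : nat) k.+1) => [->|_].
      by rewrite mulr1 ltn_eqF ?addr0 //; lia.
    by case: ifP; rewrite ?mulr0 add0r.
  have up : \sum_(j < n | j == k.+1 :> nat) ((-1) ^+ j *: continuant j) =
      if (k < n')%N then (-1) ^+ k.+1 *: continuant k.+1 else 0.
    case: ifP => [kn|kn].
      by rewrite (big_pred1 (Ordinal (kn : (k.+1 < n)%N))) // => j; rewrite -val_eqE.
    by rewrite big_pred0 // => j; apply/eqP; have := ltn_ord j; lia.
  have down : (-1) ^+ k *: continuant k * ('X - (x k)%:P) +
     \sum_(j < n | k == j.+1 :> nat) ((-1) ^+ j *: continuant j) * - (q j)%:P =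
     (-1) ^+ k *: continuant k.+1.
    case: k {up} => k kn; rewrite -[nat_of_ord (Ordinal kn)]/k.
    case: k kn => [|k] kn.
      by rewrite big_pred0 // addr0 expr0 !scale1r continuant0 mul1r continuant1.
    rewrite (big_pred1 (Ordinal (ltnW kn))) => [|j]; last first.
      by rewrite eqSS eq_sym.
    rewrite -[nat_of_ord (Ordinal _)]/k (continuantSS k).
    move: (continuant k.+1) (continuant k) => c1 c0.
    rewrite -!mul_polyC exprS mulN1r polyCN; ring.
  rewrite addrCA addrC up down; case: ifP => kn.
    rewrite exprS mulN1r scaleNr subrr -val_eqE /= ltn_eqF // mulr0 //.
  have kE : k = ord_max by apply/val_inj => /=; have := ltn_ord k; lia.
  by rewrite kE eqxx addr0 mulr1.
have /rowP/(_ 0) := congr1 (mulmx^~ (\adj (char_poly_mx M))) vM.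
rewrite -mulmxA mul_mx_adj -scalemxAl -rowE mul_mx_scalar.
rewrite [LHS]mxE [v _ _]mxE [RHS]mxE [row _ _ _ _]mxE.
rewrite expr0 scale1r mulr1 -/(char_poly M) => chE.
set c := \adj _ _ _ in chE.
pose c' := (-1) ^+ n' *: c.
have {}chE : char_poly M = c' * continuant n.
  by rewrite chE /c' -!scalerAl mulrC.
have szc : size c' = 1%N.
  have c0 : c' != 0.
    by apply: contraTneq (char_poly_monic M) => c0;
      rewrite chE c0 mul0r monicE lead_coef0 eq_sym oner_eq0.
  have := congr1 (fun p : {poly T} => size p) chE.
  rewrite size_char_poly size_Mmonic ?continuant_monic // size_continuant.
  by rewrite addnS /= -[n.+1]add1n => /addIn.
have /size_poly1P[a a0 ca] : size c' == 1%N by apply/eqP.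
have : lead_coef (char_poly M) = 1 by apply/monicP/char_poly_monic.
rewrite chE lead_coef_Mmonic ?continuant_monic // ca lead_coefC => ->.
by rewrite mul1r.
Qed.
End Continuants.

(** * Radicality in the tridiagonal case *)
Section Jacobi.
Variables (k : idomainType) (n' : nat).
Local Notation n := n'.+1.
(* The same ring in two roles: the variables of A are the superdiagonal
   parameters, those of P the unknown coefficients of the continuant of
   degree n'. *)
Local Notation P := {mpoly k[n']}.
Local Notation A := {mpoly k[n']}.
Local Notation T := {mpoly A[n]}.
Local Notation L := {fraction P}.
Local Notation tofrac := (@FracField.tofrac P).
Local Notation "x %:F" := (tofrac x).

(** The variable of index [i], extended by zero so that indices can be natural
numbers. *)
Definition nat_var i : P := if insub i is Some j then 'X_(j : 'I_n') else 0.

Lemma nat_var_ord (j : 'I_n') : nat_var j = 'X_j.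
Proof. by rewrite /nat_var valK. Qed.

Lemma nat_var_neq0 i : (i < n')%N -> nat_var i != 0.
Proof.
move=> lt; have -> : i = Ordinal lt by [].
rewrite nat_var_ord.
by rewrite -mleadc_eq0 mleadXm mcoeffX eqxx oner_eq0.
Qed.

Definition jacobi_q (r s : 'I_n) : A := if s == r.+1 :> nat then nat_var r else 0.

Local Notation H := (last_row_pow (generic_mx jacobi_q)).
Let idH := generated_ideal H.

Let xT i : T := 'X_(inord i).
Let qT i : T := (nat_var i)%:MP.

Lemma generic_mx_jacobi : generic_mx jacobi_q = jacobi_mx xT qT n'.
Proof.
congr hess_mx; apply/boolp.funext => r; first by rewrite /xT inord_val.
by apply/boolp.funext => s; rewrite /jacobi_q; case: ifP => // _; rewrite mpolyC0.
Qed.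

Let PT := continuant xT qT.

(* the variables of P take the values of the coefficients they stand for *)
Let pi : {rmorphism P -> T} :=
  mmap ((@mpolyC n A) \o (@mpolyC n' k)) (fun j : 'I_n' => (PT n')`_j).

Lemma pi_nat_var i : (i < n')%N -> pi (nat_var i) = (PT n')`_i.
Proof.
move=> lt; have -> : i = Ordinal lt by [].
by rewrite nat_var_ord /pi /= mmapX mmap1U.
Qed.
Lemma pi_const c : pi c%:MP = (c%:MP)%:MP.
Proof. by rewrite /pi /= mmapC. Qed.

(** A constant is in normal form. *)
Lemma scalar_in_ideal_eq0 c : generated H c%:MP -> c = 0.
Proof.
move=> cH; apply/eqP; rewrite -(mpolyC_eq0 n); apply/eqP.
apply: (last_row_reduced_eq0 _ cH) => m j; rewrite msuppC.
by case: ifP => // _; rewrite inE => /eqP ->; rewrite mnm0E.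
Qed.

(** The elements by which one may divide: modulo the ideal they are nonzero constants,
and constants are not zero divisors there. *)
Definition denominator (d : P) : Prop :=
  exists2 c : A, c != 0 & generated H (pi d - c%:MP).

Lemma denominator_neq0 d : denominator d -> d != 0.
Proof.
move=> [c c0 dc]; apply: contraNneq c0 => d0; apply/eqP/scalar_in_ideal_eq0.
by rewrite d0 rmorph0 sub0r in dc; rewrite -[_%:MP]opprK; apply: ideal_opp.
Qed.

Lemma denominator1 : denominator 1.
Proof.
exists 1; first exact: oner_neq0.
by rewrite rmorph1 mpolyC1 subrr; apply: ideal_zero.
Qed.

Lemma denominatorM d e : denominator d -> denominator e -> denominator (d * e).
Proof.
move=> [a a0 da] [b b0 eb]; exists (a * b); first by rewrite mulf_neq0.
rewrite rmorphM mpolyCM; move: (pi d) (pi e) a%:MP b%:MP da eb => d' e' a' b' da eb.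
have -> : d' * e' - a' * b' = (d' - a') * e' + a' * (e' - b') by ring.
by apply: (ideal_add idH); [apply: (ideal_mulr idH)|apply: (ideal_mull idH)].
Qed.

(** The fraction [l] and the polynomial [b], taken modulo the ideal, are the same
expression [G / d] in the coefficients of the continuant of degree [n'].  This
relation is compatible with the ring operations and with division by elements
that match a nonzero constant.  It will turn out to be the graph of an embedding
of the quotient ring into the field [L]. *)
Definition matches (l : L) (b : T) : Prop := exists d G : P,
  [/\ denominator d, d%:F * l = G%:F & generated H (pi d * b - pi G)].

Lemma matches_base G : matches G%:F (pi G).
Proof.
exists 1, G; split; first exact: denominator1.
- by rewrite tofrac1 mul1r.
- by rewrite rmorph1 mul1r subrr; apply: ideal_zero.
Qed.

Lemma matches_mod l b b' : generated H (b - b') -> matches l b' -> matches l b.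
Proof.
move=> bb' [d [G [dd dl db]]]; exists d, G; split=> //.
move: (pi d) (pi G) db => d' G' db.
have -> : d' * b - G' = d' * (b - b') + (d' * b' - G') by ring.
by apply: (ideal_add idH) => //; apply: (ideal_mull idH).
Qed.

Lemma matchesD l m b c : matches l b -> matches m c -> matches (l + m) (b + c).
Proof.
move=> [d [G [dd dl db]]] [e [K [de el ec]]].
exists (d * e), (e * G + d * K); split; first exact: denominatorM.
- rewrite tofracD !tofracM -dl -el mulrDr; congr (_ + _).
    by rewrite [_ * e%:F]mulrC mulrA.
  by rewrite mulrA.
- rewrite rmorphD !rmorphM.
  move: (pi d) (pi e) (pi G) (pi K) db ec => d' e' G' K' db ec.
  have -> : d' * e' * (b + c) - (e' * G' + d' * K') =
    e' * (d' * b - G') + d' * (e' * c - K') by ring.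
  by apply: (ideal_add idH); apply: (ideal_mull idH).
Qed.

Lemma matchesM l m b c : matches l b -> matches m c -> matches (l * m) (b * c).
Proof.
move=> [d [G [dd dl db]]] [e [K [de el ec]]].
exists (d * e), (G * K); split; first exact: denominatorM.
- by rewrite !tofracM -dl -el mulrACA.
- rewrite !rmorphM.
  move: (pi d) (pi e) (pi G) (pi K) db ec => d' e' G' K' db ec.
  have -> : d' * e' * (b * c) - G' * K' =
    (d' * b - G') * (e' * c) + G' * (e' * c - K') by ring.
  by apply: (ideal_add idH); [apply: (ideal_mulr idH)|apply: (ideal_mull idH)].
Qed.

Lemma matches0 : matches 0 0.
Proof. by have := matches_base 0; rewrite tofrac0 rmorph0. Qed.
Lemma matches1 : matches 1 1.
Proof. by have := matches_base 1; rewrite tofrac1 rmorph1. Qed.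
Lemma matchesN l b : matches l b -> matches (- l) (- b).
Proof.
move=> lb; have := matchesM (matches_base (-1)) lb.
by rewrite tofracN tofrac1 rmorphN1 !mulN1r.
Qed.
Lemma matchesB l m b c : matches l b -> matches m c -> matches (l - m) (b - c).
Proof. by move=> lb mc; apply/matchesD/matchesN. Qed.
Lemma matches_sum (I : Type) (r : seq I) (F : I -> L) (G : I -> T) :
  (forall i, matches (F i) (G i)) -> matches (\sum_(i <- r) F i) (\sum_(i <- r) G i).
Proof.
move=> FG; elim/big_ind2: _ => //; first exact: matches0.
by move=> l b m c; apply: matchesD.
Qed.

Lemma matches0_ideal b : matches 0 b -> generated H b.
Proof.
move=> [d [G [[c c0 dc] + db]]]; rewrite mulr0 => /esym/eqP.
rewrite tofrac_eq0 => /eqP G0; move: db; rewrite G0 rmorph0 subr0 => db.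
apply: (last_row_torsion_free c0).
have -> : c%:MP * b = pi d * b - (pi d - c%:MP) * b by rewrite mulrBl subKr.
by apply: (ideal_sub idH) => //; apply: (ideal_mulr idH).
Qed.

Lemma numerator_denominator d G c : denominator d -> c != 0 ->
  generated H (pi d * c%:MP - pi G) -> denominator G.
Proof.
move=> [a a0 da] c0 dc; exists (a * c); first by rewrite mulf_neq0.
rewrite mpolyCM; move: (pi d) (pi G) a%:MP c%:MP da dc => d' G' a' c' da dc.
have -> : G' - a' * c' = (d' - a') * c' - (d' * c' - G') by ring.
by apply: (ideal_sub idH) => //; apply: (ideal_mulr idH).
Qed.

Lemma matches_scalar_neq0 l c : c != 0 -> matches l c%:MP -> l != 0.
Proof.
move=> c0 [d [G [dd dl /(numerator_denominator dd c0) dG]]].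
apply: contraNneq (denominator_neq0 dG) => l0.
by rewrite -tofrac_eq0 -dl l0 mulr0.
Qed.

Lemma matches_div l m b c : c != 0 -> matches l c%:MP ->
  matches (l * m) (c%:MP * b) -> matches m b.
Proof.
move=> c0 [d [G [dd dl dc]]] [e [K [de elm ecb]]].
exists (e * G), (d * K); split.
- exact: denominatorM de (numerator_denominator dd c0 dc).
- rewrite !tofracM -dl -elm; move: (tofrac d) (tofrac e) => d' e'.
  by rewrite [e' * _]mulrCA -[LHS]mulrA -[e' * l * m]mulrA.
- rewrite !rmorphM.
  move: (pi d) (pi e) (pi G) (pi K) c%:MP dc ecb => d' e' G' K' c' dc ecb.
  have -> : e' * G' * b - d' * K' =
    d' * (e' * (c' * b) - K') - e' * b * (d' * c' - G') by ring.
  by apply: (ideal_sub idH); apply: (ideal_mull idH).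
Qed.

Definition matches_poly (a : {poly L}) (b : {poly T}) : Prop :=
  forall i, matches a`_i b`_i.

Lemma matches_polyB a1 a2 b1 b2 :
  matches_poly a1 b1 -> matches_poly a2 b2 -> matches_poly (a1 - a2) (b1 - b2).
Proof. by move=> m1 m2 i; rewrite !coefB; apply: matchesB. Qed.

Lemma matches_polyM a1 a2 b1 b2 :
  matches_poly a1 b1 -> matches_poly a2 b2 -> matches_poly (a1 * a2) (b1 * b2).
Proof.
by move=> m1 m2 i; rewrite !coefM; apply: matches_sum => j; apply: matchesM.
Qed.

Lemma matches_polyX : matches_poly 'X 'X.
Proof.
by move=> i; rewrite !coefX; case: eqP => _; [apply: matches1|apply: matches0].
Qed.

Lemma matches_polyC l b : matches l b -> matches_poly l%:P b%:P.
Proof. by move=> m i; rewrite !coefC; case: eqP => // _; apply: matches0. Qed.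

(* Euclidean division of monic polynomials a by b of degrees d+1 and d *)
(** One Euclidean step, for [a] and [b] monic of degrees [d.+1] and [d]: the quotient
is ['X - shift], and the remainder is made monic. *)
Definition shift (d : nat) (a b : {poly L}) : L := ('X * b)`_d - a`_d.
Definition remainder d a b : {poly L} := a - ('X - (shift d a b)%:P) * b.
Definition euclid_step d (ab : {poly L} * {poly L}) : {poly L} * {poly L} :=
  let r := remainder d ab.1 ab.2 in (ab.2, (r`_d.-1)^-1 *: r).

(** The [j]-th pair should consist of the continuants of degrees [n - j] and
[n' - j]. *)
Fixpoint euclid j : {poly L} * {poly L} :=
  if j is j'.+1 then euclid_step (n' - j') (euclid j')
  else ('X^n, 'X^n' + \poly_(i < n') (nat_var i)%:F).

(* the continuant of degree i, and the parameters found on the way down to it *)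
Let PL i := (euclid (n - i)).1.
Let xL i := shift i (PL i.+1) (PL i).
Let qL i := (remainder i.+1 (PL i.+2) (PL i.+1))`_i.

Lemma euclid_quotient i : (i < n')%N ->
  PL i = (qL i)^-1 *: remainder i.+1 (PL i.+2) (PL i.+1).
Proof.
move=> lt; rewrite /qL /PL.
have -> : (n - i = (n' - i.+1).+2)%N by lia.
have -> : (n - i.+1 = (n' - i.+1).+1)%N by lia.
have -> : (n - i.+2 = n' - i.+1)%N by lia.
by rewrite /= (_ : n' - (n' - i.+1) = i.+1)%N; last lia.
Qed.

Definition monic_of_degree (U : comNzRingType) d (p : {poly U}) : Prop :=
  p`_d = 1 /\ forall i, (d < i)%N -> p`_i = 0.

Lemma euclid_base :
  [/\ matches_poly (PL n) (PT n), monic_of_degree n (PL n),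
      matches_poly (PL n') (PT n') & monic_of_degree n' (PL n')].
Proof.
have PLn : PL n = 'X^n by rewrite /PL subnn.
have PLn' : PL n' = 'X^n' + \poly_(i < n') (nat_var i)%:F.
  by rewrite /PL subSnn /=.
split.
- move=> i; rewrite PLn coefXn.
  have [ni|ni|->] := ltngtP i n; last first.
  + by rewrite continuant_lead; apply: matches1.
  + by rewrite continuant_coef_gt //; apply: matches0.
  apply: (@matches_mod _ _ 0); last exact: matches0.
  rewrite subr0 generic_mx_jacobi; apply/generated_last_row_pow.
  rewrite -/(jacobi_mx xT qT n') char_poly_jacobi_mx.
  exact: (generated_gen (fun j : 'I_n => (continuant xT qT n)`_j) (Ordinal ni)).
- rewrite PLn; split=> [|i ni]; rewrite coefXn ?eqxx //.
  by rewrite gtn_eqF.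
- move=> i; rewrite PLn' coefD coefXn coef_poly.
  have [ni|ni|->] := ltngtP i n'.
  + by rewrite add0r -pi_nat_var //; apply: matches_base.
  + by rewrite continuant_coef_gt // addr0; apply: matches0.
  + by rewrite continuant_lead addr0; apply: matches1.
- rewrite PLn'; split=> [|i ni]; rewrite coefD coefXn coef_poly.
    by rewrite eqxx ltnn addr0.
  by rewrite gtn_eqF // ltnNge ltnW // addr0.
Qed.

Lemma xT_shift i : xT i = ('X * PT i)`_i - (PT i.+1)`_i.
Proof.
case: i => [|i].
  rewrite /PT continuant1 continuant0 mulr1 coefB coefC /=.
  by rewrite opprB addrC subrK.
rewrite {2}/PT continuantSS coefD coefZ continuant_coef_gt // mulr0 addr0.
rewrite mulrBl coefB coefCM continuant_lead mulr1.
by rewrite opprB addrC subrK.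
Qed.

Lemma matches_shift i : matches_poly (PL i.+1) (PT i.+1) ->
  matches_poly (PL i) (PT i) -> matches (xL i) (xT i).
Proof.
move=> m1 m0; rewrite xT_shift; apply: (matchesB _ (m1 i)).
exact: (matches_polyM matches_polyX m0).
Qed.

(** Descending induction.  The remainder in [L] matches the constant [qT i] times a
continuant, so its coefficient [qL i] matches a nonzero constant and is not zero.
Hence the division by [qL i] is legitimate and has its counterpart modulo the
ideal. *)
Lemma euclid_inv i : (i <= n')%N ->
  [/\ matches_poly (PL i.+1) (PT i.+1), monic_of_degree i.+1 (PL i.+1),
      matches_poly (PL i) (PT i) & monic_of_degree i (PL i)]
  /\ ((i < n')%N -> matches (qL i) (qT i) /\ qL i != 0).
Proof.
move=> le; rewrite -(subKn le); move: (n' - i)%N (leq_subr i n') => {le i} j.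
elim: j => [|j IH] jn; first by rewrite subn0 ltnn; split=> //; exact: euclid_base.
have [] := IH (ltnW jn); have -> : (n' - j = (n' - j.+1).+1)%N by lia.
have : (n' - j.+1 < n')%N by lia.
move: (n' - j.+1)%N => i {IH jn} iltn [m2 [lead2 gt2] m1 [lead1 gt1]] _.
have mR : matches_poly (remainder i.+1 (PL i.+2) (PL i.+1)) (qT i *: PT i).
  have -> : qT i *: PT i = PT i.+2 - ('X - (xT i.+1)%:P) * PT i.+1.
    by rewrite [PT i.+2]continuantSS addrC addKr.
  apply: (matches_polyB m2); apply: (matches_polyM _ m1).
  apply: (matches_polyB matches_polyX); apply: matches_polyC.
  exact: (matches_shift m2 m1).
have mq : matches (qL i) (qT i).
  by have := mR i; rewrite coefZ continuant_lead mulr1.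
have q0 : qL i != 0 by apply: (matches_scalar_neq0 (nat_var_neq0 iltn) mq).
split; last by move=> _; split.
split; [exact: m1|split; [exact: lead1|exact: gt1]|move=> l|].
- apply: (matches_div (nat_var_neq0 iltn) mq).
  by rewrite (euclid_quotient iltn) coefZ mulVKf // -coefZ; apply: mR.
- rewrite (euclid_quotient iltn); split=> [|l il]; first by rewrite coefZ mulVf.
  rewrite coefZ /remainder coefB mulrBl coefB coefXM coefCM.
  case: l il => // l il; move: il; rewrite ltnS leq_eqVlt => /orP[/eqP <-|il].
    by rewrite lead1 mulr1 /shift coefXM /= subKr subrr mulr0.
  have b0 : (PL i.+1)`_l.+1 = 0 by apply: gt1.
  rewrite b0 mulr0 subr0 /=; move: il; rewrite leq_eqVlt => /orP[/eqP <-|il].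
    by rewrite lead1 lead2 subrr mulr0.
  by rewrite gt1 // gt2 // subrr mulr0.
Qed.

Lemma euclid_continuant i : (i <= n)%N -> PL i = continuant xL qL i.
Proof.
have PL0 : PL 0 = 1.
  have [[_ _ _ [lead0 gt0]] _] := @euclid_inv 0 (leq0n _).
  by apply/polyP => -[|j]; rewrite coef1 // gt0.
have PL1 : PL 1 = continuant xL qL 1.
  have [[_ [lead1 gt1] _ _] _] := @euclid_inv 0 (leq0n _).
  rewrite continuant1 /xL /shift PL0 mulr1 coefX sub0r.
  apply/polyP => -[|[|j]]; rewrite coefB coefX coefC /= ?subr0.
  - by rewrite sub0r opprK.
  - exact: lead1.
  - by rewrite gt1.
have both j : (j <= n')%N -> PL j = continuant xL qL j /\ PL j.+1 = continuant xL qL j.+1.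
  elim: j => [|j IH] lt; first by split; [exact: PL0|exact: PL1].
  have [IH0 IH1] := IH (ltnW lt); split; first exact: IH1.
  have [_ /(_ lt)[_ q0]] := euclid_inv (ltnW lt).
  rewrite continuantSS -IH0 -IH1 [X in _ = _ + _ *: X]euclid_quotient //.
  by rewrite scalerA divff // scale1r /remainder addrC subrK.
by case: i => [|i] ilt; [exact: PL0|case: (both i ilt)].
Qed.

(** The parameters in [L] form a nilpotent matrix: its characteristic polynomial is
the continuant from which the algorithm started. *)
Lemma last_row_pow_euclid : last_row_pow (jacobi_mx xL qL n') =1 fun=> 0.
Proof.
move=> j; have : generated (last_row_pow (jacobi_mx xL qL n'))
    (last_row_pow (jacobi_mx xL qL n') j).
  exact: generated_gen.
move/generated_last_row_pow; rewrite -/(jacobi_mx xL qL n') char_poly_jacobi_mx.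
rewrite -euclid_continuant // /PL subnn /= => -[c ->].
by rewrite big1 // => i _; rewrite coefXn ltn_eqF // mulr0.
Qed.

Let evA : {rmorphism A -> L} :=
  mmap (tofrac \o @mpolyC n' k) (fun j : 'I_n' => qL j).
Let ev : {rmorphism T -> L} := mmap evA (fun i : 'I_n => xL i).

(** All the generators of [T] have matching fractions, so every element has one. *)
Lemma matches_ev f : matches (ev f) f.
Proof.
have matches_exp l b e : matches l b -> matches (l ^+ e) (b ^+ e).
  move=> lb; elim: e => [|e IH]; first exact: matches1.
  by rewrite !exprS; apply: matchesM.
have matches_prod (I : finType) (F : I -> L) (G : I -> T) :
    (forall i, matches (F i) (G i)) -> matches (\prod_i F i) (\prod_i G i).
  move=> FG; elim/big_ind2: _ => //; first exact: matches1.
  by move=> l b m c; apply: matchesM.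
have matches_A c : matches (evA c) c%:MP.
  rewrite (mpolyE c) !rmorph_sum; apply: matches_sum => m.
  rewrite -mul_mpolyC !rmorphM; apply: matchesM.
    by rewrite /evA /= mmapC -pi_const; apply: matches_base.
  rewrite mpolyXE_id !rmorph_prod; apply: matches_prod => j.
  rewrite !rmorphXn; apply: matches_exp.
  rewrite /evA /= mmapX mmap1U -nat_var_ord.
  by have [_ /(_ (ltn_ord j))[]] := euclid_inv (ltnW (ltn_ord j)).
rewrite (mpolyE f) rmorph_sum; apply: matches_sum => m.
rewrite -mul_mpolyC rmorphM; apply: matchesM.
  by rewrite /ev /= mmapC; apply: matches_A.
rewrite mpolyXE_id rmorph_prod; apply: matches_prod => j.
rewrite rmorphXn; apply: matches_exp.
rewrite /ev /= mmapX mmap1U -[X in matches _ 'X_X]inord_val.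
have [[m1 _ m0 _] _] := euclid_inv (ltn_ord j : (j <= n')%N).
exact: matches_shift.
Qed.

(** A nilpotent has nilpotent, hence zero, image in [L]; and only elements of the
ideal match zero. *)
Lemma radical_jacobi : radical (generated H).
Proof.
move=> f e fe; apply: matches0_ideal.
suff <- : ev f = 0 by exact: matches_ev.
suff : ev f ^+ e = 0 by move/eqP; rewrite expf_eq0 => /andP[_ /eqP].
rewrite -rmorphXn; case: fe => c ->.
rewrite rmorph_sum big1 // => j _; rewrite rmorphM map_last_row_pow.
rewrite generic_mx_jacobi /jacobi_mx map_hess_mx.
suff -> : hess_mx (ev \o (fun i : 'I_n => xT i))
    (fun r s : 'I_n => ev (if s == r.+1 :> nat then qT r else 0)) = jacobi_mx xL qL n'.
  by rewrite last_row_pow_euclid mulr0.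
apply/matrixP => r s; rewrite !mxE /=.
case: eqP => [_|_]; first by rewrite /ev /xT /= mmapX mmap1U inord_val.
case: eqP => // _; case: ifP => // _; case: eqP => [sr|_]; last by rewrite rmorph0.
have rn : (r < n')%N by rewrite -ltnS -sr.
rewrite /ev /qT /= mmapC /evA /= -[nat_var r]/(nat_var (Ordinal rn)) nat_var_ord.
by rewrite mmapX mmap1U.
Qed.
End Jacobi.

(** * The ideal of the quantized elementary polynomials *)
Lemma eq_mpoly_rmorph (R S : comNzRingType) m (f g : {rmorphism {mpoly R[m]} -> S}) :
  (forall c, f c%:MP = g c%:MP) -> (forall i, f 'X_i = g 'X_i) -> f =1 g.
Proof.
move=> fgC fgX p; rewrite (mpolyE p) !rmorph_sum; apply: eq_bigr => u _.
rewrite -mul_mpolyC !rmorphM fgC; congr (_ * _).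
rewrite mpolyXE_id !rmorph_prod; apply: eq_bigr => i _.
by rewrite !rmorphXn fgX.
Qed.

(** Given values [c r s] for the parameters, let those on the first superdiagonal
become independent and multiply the others by a variable.  The values are
recovered by [rho]. *)
Lemma radical_deformation (T : idomainType) (n' : nat) (c : 'I_n'.+1 -> 'I_n'.+1 -> T) :
  exists (A : idomainType) (q : 'I_n'.+1 -> 'I_n'.+1 -> A)
         (kappa : {rmorphism T -> A}) (rho : {rmorphism A -> T}),
  [/\ cancel kappa rho,
      forall r s : 'I_n'.+1, (r < s)%N -> rho (q r s) = c r s,
      forall r s : 'I_n'.+1, s != r.+1 :> nat -> c r s = 0 -> q r s = 0 &
      radical (generated (last_row_pow (generic_mx q)))].
Proof.
pose A : idomainType := {poly {mpoly T[n']}}.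
pose q (r s : 'I_n'.+1) : A :=
  if s == r.+1 :> nat then (nat_var T n' r)%:P else 'X * ((c r s)%:MP)%:P.
pose kappa : {rmorphism T -> A} := polyC \o (@mpolyC n' T).
pose rho : {rmorphism A -> T} :=
  meval (fun j : 'I_n' => c (inord j) (inord j.+1)) \o horner_eval 1.
exists A, q, kappa, rho; split.
- by move=> a; rewrite /rho /kappa /= /horner_eval hornerC mevalC.
- move=> r s rs; rewrite /rho /= /horner_eval /q.
  case: eqP => [sr|_]; last by rewrite hornerM hornerX hornerC mul1r mevalC.
  have rn : (r < n')%N by rewrite -ltnS -sr.
  rewrite hornerC -[nat_of_ord r]/(nat_of_ord (Ordinal rn)) nat_var_ord mevalXU /=.
  by rewrite -sr !inord_val.
- by move=> r s rs c0; rewrite /q (negPf rs) c0 mpolyC0 polyC0 mulr0.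
apply: radical_specialization.
suff -> : (fun r s => (q r s).[0]) = @jacobi_q T n' by exact: radical_jacobi.
apply/boolp.funext => r; apply/boolp.funext => s; rewrite /q /jacobi_q.
by case: eqP => _; rewrite ?hornerC // hornerM hornerX mul0r.
Qed.

Section HessenbergIdeal.
Variables (K : fieldType) (n' : nat) (h : hessenberg n'.+1).
Local Notation n := n'.+1.
Local Notation T := {mpoly K[#|{: hvar h}|]}.

(* the variables of the smaller ring; a dropped q_rs is zero *)
Definition kept_x (i : 'I_n) : T := 'X_(enum_rank (inl i : hvar h)).
Definition kept_q (r s : 'I_n) : T :=
  if insub (r, s) is Some t then 'X_(enum_rank (inr (t : hq_index h) : hvar h)) else 0.
Definition kept_mx : 'M[T]_n := hess_mx kept_x kept_q.

Definition kept_mx_at (z : 'I_#|{: hvar h}| -> K) : 'M[K]_n := map_mx (meval z) kept_mx.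

Lemma map_matM :
  map_mx (comp_mpoly [tuple hsubst K h (enum_val k) | k < #|{: full_var n}|]) (matM K n) = kept_mx.
Proof.
apply/matrixP => r s; rewrite !mxE; case: eqP => [->|_].
  by rewrite /var_x comp_mpolyXU -tnth_nth tnth_mktuple enum_rankK.
case: eqP => [_|_]; first by rewrite rmorphN1.
case: insubP => [t lt tE|]; last by move/negPf => /= ->; rewrite rmorph0.
by rewrite /var_q comp_mpolyXU -tnth_nth tnth_mktuple enum_rankK /= tE ifT.
Qed.

Lemma hE_char_poly (i : 'I_n) : hE K h i.+1 = (-1) ^+ i.+1 * (char_poly kept_mx)`_(n' - i).
Proof.
rewrite /hE /E_poly rmorphM rmorphXn rmorphN1 subSS; congr (_ * _).
by rewrite -map_matM -map_char_poly coef_map.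
Qed.

Lemma hE_idealE a : hE_ideal K h a <-> generated (last_row_pow kept_mx) a.
Proof.
split.
- move=> /asboolP [c ->]; apply/generated_last_row_pow.
  apply: (ideal_sum (generated_ideal _)) => i _; rewrite hE_char_poly mulrA.
  apply: (ideal_mull (generated_ideal _)).
  have lt : (n' - i < n)%N by lia.
  exact: (generated_gen (fun j : 'I_n => (char_poly kept_mx)`_j) (Ordinal lt)).
- move/generated_last_row_pow => [c ->]; apply/asboolP.
  exists (fun i : 'I_n => (-1) ^+ i.+1 * c (rev_ord i)).
  rewrite [LHS](reindex_inj rev_ord_inj); apply: eq_bigr => i _.
  rewrite hE_char_poly mulrACA -expr2 sqrr_sign mul1r.
  by rewrite /= subSS.
Qed.

Lemma generated_last_row_pow_map (U V : comNzRingType) (f : {rmorphism U -> V}) (M : 'M[U]_n) a :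
  generated (last_row_pow M) a -> generated (last_row_pow (map_mx f M)) (f a).
Proof.
move=> [c ->]; exists (f \o c); rewrite rmorph_sum; apply: eq_bigr => k _.
by rewrite rmorphM map_last_row_pow.
Qed.

Section Deformation.
Variables (A : idomainType) (qA : 'I_n -> 'I_n -> A).
Variables (iota : {rmorphism K -> A}) (rho : {rmorphism A -> T}).
Hypothesis rho_iota : forall c, rho (iota c) = c%:MP.
Hypothesis rho_q : forall r s : 'I_n, (r < s)%N -> rho (qA r s) = kept_q r s.
Hypothesis q_out : forall r s : 'I_n, (r < s)%N -> ~~ q_kept h (r, s) -> qA r s = 0.

Let deform : {rmorphism T -> {mpoly A[n]}} :=
  mmap (@mpolyC n A \o iota)
    (fun v => match enum_val v with
              | inl i => 'X_i
              | inr t => (qA (val t).1 (val t).2)%:MP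
              end).

Let undeform : {rmorphism {mpoly A[n]} -> T} := mmap rho kept_x.

Lemma deformX v : deform 'X_v = match enum_val v with
    | inl i => 'X_i
    | inr t => (qA (val t).1 (val t).2)%:MP
    end.
Proof. by rewrite /deform /= mmapX mmap1U. Qed.

Lemma undeformX i : undeform 'X_i = kept_x i.
Proof. by rewrite /undeform /= mmapX mmap1U. Qed.

Lemma undeformC c : undeform c%:MP = rho c.
Proof. by rewrite /undeform /= mmapC. Qed.

Lemma deformK f : undeform (deform f) = f.
Proof.
apply: (eq_mpoly_rmorph (f := undeform \o deform) (g := idfun)) => [c|v].
  by rewrite -[LHS]/(undeform (deform _)) /deform /= mmapC undeformC rho_iota.
rewrite -[LHS]/(undeform (deform _)) deformX -[in RHS](enum_valK v).
case: (enum_val v) => [i|t]; first exact: undeformX.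
rewrite undeformC rho_q; last by case: t => [[r s]] /= /andP[].
by rewrite /kept_q -surjective_pairing valK.
Qed.

Lemma map_deform : map_mx deform kept_mx = generic_mx qA.
Proof.
rewrite map_hess_mx; apply/matrixP => r s; rewrite !mxE -[(_ \o _) r]/(deform (kept_x r)).
case: eqP => [_|_]; first by rewrite /kept_x deformX enum_rankK.
case: eqP => // _; case: ifP => // rs; rewrite /kept_q; case: insubP => [t _ tE|nk].
  by rewrite deformX enum_rankK tE.
by rewrite rmorph0 q_out ?mpolyC0.
Qed.

Lemma map_undeform : map_mx undeform (generic_mx qA) = kept_mx.
Proof.
rewrite map_hess_mx; apply/matrixP => r s; rewrite !mxE -[(_ \o _) r]/(undeform 'X_r).
case: eqP => [_|_]; first exact: undeformX.
by case: eqP => // _; case: ifP => // rs; rewrite undeformC rho_q.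
Qed.

(** The ring is a retract of a ring in which the ideal is known to be radical, and the
two maps exchange the ideals. *)
Lemma radical_undeform :
  radical (generated (last_row_pow (generic_mx qA))) -> radical (generated (last_row_pow kept_mx)).
Proof.
move=> rad f e /(generated_last_row_pow_map deform); rewrite rmorphXn map_deform => fe.
rewrite -[f]deformK -map_undeform; apply: generated_last_row_pow_map.
exact: rad fe.
Qed.
End Deformation.

Hypothesis h_ind : indecomposable h.

(** The only use of indecomposability. *)
Lemma superdiag_kept (r s : 'I_n) : s = r.+1 :> nat -> q_kept h (r, s).
Proof.
move=> sr; rewrite /q_kept sr ltnSn andbT.
have := @h_ind (rev_ord s); rewrite /= => /(_ ltac:(have := ltn_ord s; lia)).
have := ltn_ord s; lia.
Qed.

Lemma radical_kept_mx : radical (generated (last_row_pow kept_mx)).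
Proof.
have [A [qA [kappa [rho [kappaK rho_q q0 rad]]]]] := radical_deformation kept_q.
apply: (@radical_undeform A qA (kappa \o @mpolyC _ K) rho) rad => //.
- by move=> c /=; rewrite kappaK.
- move=> r s rs nk; apply: q0; last by rewrite /kept_q insubN.
  by apply: contraNneq nk; apply: superdiag_kept.
Qed.
End HessenbergIdeal.

Section Zeros.
Variables (K : closedFieldType) (n' : nat) (h : hessenberg n'.+1).
Local Notation n := n'.+1.
Hypothesis K_uncountable : forall e : K -> nat,
  exists j, forall s : seq K, exists2 x, x \notin s & e x = j.
Hypothesis h_ind : indecomposable h.

Lemma hE_ideal_zeros p :
  hE_ideal K h p <-> forall z, last_row_pow (kept_mx_at z) =1 (fun=> 0) -> p.@[z] = 0.
Proof.
split.
- move/hE_idealE => pI z kz; move: (generated_last_row_pow_map (meval z) pI).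
  by case=> c ->; rewrite big1 // => i _; rewrite kz mulr0.
- move=> van; apply/hE_idealE; have [|e] := nullstellensatz K_uncountable
    (generated_ideal (last_row_pow (kept_mx K h))) (f := p).
    move=> z Iz; apply: van => k; rewrite /kept_mx_at -map_last_row_pow.
    by apply/Iz/generated_gen.
  exact: radical_kept_mx.
Qed.
End Zeros.

(** * Membership in a Hessenberg variety, in matrix terms *)
Section Flag.
Variables (K : fieldType) (n : nat) (g : 'M[K]_n).
Hypothesis gU : g \in unitmx.

(** In the coordinates given by the columns of [g], the flag is the standard one. *)
Lemma mem_flag_of (c : 'I_n) (v : 'cV[K]_n) :
  (v \in flag_of g c) = [forall a : 'I_n, (c < a)%N ==> ((invmx g *m v) a 0 == 0)].
Proof.
have size_cols : size [seq col k g | k : 'I_n] = n.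
  by rewrite size_map -cardE card_ord.
have nth_cols (k : 'I_n) : nth 0 [seq col l g | l : 'I_n] k = col k g.
  by rewrite (nth_map k) ?size_enum_ord // nth_ord_enum.
apply/idP/forallP => [vc a|van].
  apply/implyP => ca.
  pose f : 'Hom('cV[K]_n, 'cV[K]_1) := linfun (row a \o mulmx (invmx g)).
  suff : v \in lker f.
    by rewrite memv_ker lfunE /= => /eqP/colP/(_ 0); rewrite !mxE => ->.
  move: v vc; apply/subvP/span_subvP => u /(nthP 0)[k].
  rewrite size_take_min size_cols leq_min => /andP[kc kn].
  rewrite nth_take // -[k]/(val (Ordinal kn)) nth_cols => <-.
  rewrite memv_ker lfunE /=; apply/eqP/colP => l.
  rewrite colE mulmxA mulVmx // mul1mx !mxE.
  by rewrite -val_eqE /= gtn_eqF // (leq_ltn_trans _ ca).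
have -> : v = \sum_a (invmx g *m v) a 0 *: col a g.
  rewrite -[LHS](mulKVmx gU); apply/colP => i; rewrite !mxE summxE.
  by apply: eq_bigr => j _; rewrite !mxE mulrC.
apply: memv_suml => a _; have := van a.
have [ca /eqP -> | ac _] := ltnP c a; first by rewrite scale0r mem0v.
apply/memvZ/memv_span; rewrite -nth_cols -(nth_take _ (_ : a < c.+1)%N) //.
by rewrite mem_nth // size_take_min size_cols leq_min ltnS ac /=.
Qed.

Lemma in_Hess_flag_of (h : hessenberg n) :
  in_Hess h (flag_of g) <->
  forall a b : 'I_n, (h b < a)%N -> (invmx g *m jordan_nilp K n *m g) a b = 0.
Proof.
set W := _ *m g; set N := jordan_nilp K n.
have WE a b : W a b = (invmx g *m (N *m col b g)) a 0.
  by rewrite /W -mulmxA !colE !mulmxA -colE !mxE.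
have col_in (b c : 'I_n) : (b <= c)%N -> col b g \in flag_of g c.
  move=> bc; rewrite mem_flag_of; apply/forallP => a; apply/implyP => ca.
  rewrite colE mulmxA mulVmx // mul1mx !mxE -val_eqE /= gtn_eqF //.
  exact: leq_ltn_trans ca.
split=> [[_ NV] a b hba|W0].
  have : N *m col b g \in flag_of g (h b).
    apply: (subvP (NV b)); apply/memv_imgP; exists (col b g).
      exact: col_in.
    by rewrite lfunE.
  by rewrite mem_flag_of => /forallP/(_ a); rewrite hba -WE => /eqP.
split=> [|i]; first exact: flag_of_is_flag.
apply/subvP => _ /memv_imgP[v vi ->]; rewrite lfunE /=.
move: vi; rewrite !mem_flag_of => /forallP vi.
apply/forallP => a; apply/implyP => hia.
have -> : invmx g *m (N *m v) = W *m (invmx g *m v).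
  by rewrite /W -!mulmxA mulKVmx.
rewrite mxE big1 // => b _.
have [ib|bi] := ltnP i b; first by have := vi b; rewrite ib => /eqP ->; rewrite mulr0.
by rewrite W0 ?mul0r // (leq_ltn_trans _ hia) // hess_mono.
Qed.
End Flag.

(** * Row bases generated by a cyclic vector *)
Section CyclicBasis.
Variables (T : comNzRingType) (n' : nat).
Local Notation n := n'.+1.
Implicit Types (M g W : 'M[T]_n).

Definition shift_mx : 'M[T]_n := \matrix_(i, j) (j == i.+1 :> nat)%:R.

(** The half turn with a change of sign: it exchanges [M_n] with the matrices having
ones just above the diagonal and zeros further up. *)
Definition neg_rot M : 'M[T]_n := \matrix_(a, b) - M (rev_ord a) (rev_ord b).

(** Row [i] of the unipotent matrix attached to [M]: up to the half turn, it is the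
first basis vector times the [i]-th power of [neg_rot M]. *)
Definition signed_row M (i : nat) (j : 'I_n) : T := (-1) ^+ i * (M ^+ i) ord_max (rev_ord j).

Lemma signed_rowS M i j : \sum_b signed_row M i b * neg_rot M b j = signed_row M i.+1 j.
Proof.
rewrite /signed_row [M ^+ i.+1]exprSr mxE mulr_sumr (reindex_inj rev_ord_inj) /=.
apply: eq_bigr => b _; rewrite mxE rev_ordK exprSr.
by rewrite mulrN mulrN1 mulNr mulrA.
Qed.

Lemma signed_row0 M (j : 'I_n) : signed_row M 0 j = (j == 0 :> nat)%:R.
Proof.
rewrite /signed_row !expr0 mul1r mxE -val_eqE /=; congr (nat_of_bool _)%:R.
by have := ltn_ord j; lia.
Qed.

Lemma signed_row_top M (j : 'I_n) : signed_row M n j = (-1) ^+ n * last_row_pow M (rev_ord j).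
Proof. by []. Qed.

Lemma shift_mx_mulS g (i i1 j : 'I_n) : i1 = i.+1 :> nat -> (shift_mx *m g) i j = g i1 j.
Proof.
move=> i1E; rewrite mxE (bigD1 i1) //= mxE -i1E eqxx mul1r big1 ?addr0 // => k.
by rewrite -val_eqE mxE -i1E => /negPf ->; rewrite mul0r.
Qed.

Lemma shift_mx_mul_max g (j : 'I_n) : (shift_mx *m g) ord_max j = 0.
Proof.
by rewrite mxE big1 // => k _; rewrite mxE ltn_eqF ?mul0r ?ltn_ord.
Qed.

(** Multiplication by [neg_rot M] moves each row to the next one, as does the shift,
which sends the last row to zero. *)
Lemma signed_row_intertwines M g : (forall i j, g i j = signed_row M i j) ->
  last_row_pow M =1 (fun=> 0) -> g *m neg_rot M = shift_mx *m g.
Proof.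
move=> gE kry; apply/matrixP => i j; rewrite mxE.
under eq_bigr do rewrite gE; rewrite signed_rowS.
have [lt|ge] := ltnP i n'.
  by rewrite (@shift_mx_mulS _ _ (Ordinal (lt : (i.+1 < n)%N))) // gE.
have -> : i = ord_max by apply/val_inj => /=; have := ltn_ord i; lia.
by rewrite shift_mx_mul_max signed_row_top kry mulr0.
Qed.

(** The relation determines [g] from its first row. *)
Lemma intertwines_signed_row M g : (forall j, g ord0 j = (j == 0 :> nat)%:R) ->
  g *m neg_rot M = shift_mx *m g ->
  (forall i j, g i j = signed_row M i j) /\ last_row_pow M =1 (fun=> 0).
Proof.
move=> g0 gM.
have gE : forall i j, g i j = signed_row M i j.
  case; elim=> [|i IH] lt j.
    by rewrite signed_row0 -g0; congr (g _ _); apply/val_inj.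
  rewrite -(@shift_mx_mulS g (Ordinal (ltnW lt))) // -gM mxE.
  by under eq_bigr do rewrite IH; rewrite signed_rowS.
split=> // j; have := congr1 (fun B : 'M_n => B ord_max (rev_ord j)) gM.
rewrite shift_mx_mul_max mxE; under eq_bigr do rewrite gE.
rewrite signed_rowS signed_row_top rev_ordK.
by move/(congr1 ( *%R ((-1) ^+ n))); rewrite mulrA -expr2 sqrr_sign mul1r mulr0.
Qed.

(** Since [g] is lower unipotent, the first row of [W] is a row of [shift_mx *m g] and
the others follow by subtracting multiples of earlier rows, which vanish in the
columns concerned. *)
Lemma intertwiner_superdiag g W : (forall i j : 'I_n, (i < j)%N -> g i j = 0) ->
  (forall i, g i i = 1) -> g *m W = shift_mx *m g ->
  forall a b : 'I_n, (a < b)%N -> W a b = (b == a.+1 :> nat)%:R.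
Proof.
move=> g_low g_diag gW [a lta] b; elim/ltn_ind: a lta => a IH lta /= ab.
have := congr1 (fun B : 'M_n => B (Ordinal lta) b) gW.
have lt1 : (a.+1 < n)%N by apply: leq_ltn_trans ab _.
rewrite (@shift_mx_mulS _ _ (Ordinal lt1)) // mxE.
rewrite (bigD1 (Ordinal lta)) //= g_diag mul1r big1 => [|k]; last first.
  rewrite -val_eqE /= neq_ltn => /orP[ka|ak]; last by rewrite g_low ?mul0r.
  case: k ka => k kn /= ka; rewrite IH //=; last exact: ltn_trans ab.
  by rewrite gtn_eqF ?mulr0 // (leq_ltn_trans ka).
rewrite addr0 => ->; have [bE|bn] := eqVneq (b : nat) a.+1.
  have -> : b = Ordinal lt1 by apply/val_inj.
  exact: g_diag.
by rewrite g_low //= ltn_neqAle eq_sym bn.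
Qed.
End CyclicBasis.

Section Chart.
Variables (T : comNzRingType) (n' : nat).
Local Notation n := n'.+1.
Local Notation low_var := #|{: low_pos n}|.

(** The chart of the cell over any ring, so that it can be used for the generic point
as well as for points over a field. *)
Definition unip_mx (y : 'I_low_var -> T) : 'M[T]_n :=
  \matrix_(i, j)
    if insub (i, j) is Some t then y (enum_rank (t : low_pos n))
    else (i == j)%:R.

Lemma unip_mx_low y (i j : 'I_n) : (i < j)%N -> unip_mx y i j = 0.
Proof.
move=> ij; rewrite mxE insubN /=; last by rewrite -leqNgt ltnW.
by rewrite -val_eqE ltn_eqF.
Qed.

Lemma unip_mx_diag y (i : 'I_n) : unip_mx y i i = 1.
Proof. by rewrite mxE insubN /= ?ltnn // eqxx. Qed.

Lemma det_unip_mx y : \det (unip_mx y) = 1.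
Proof.
rewrite det_trig; last by apply/is_trig_mxP => i j; apply: unip_mx_low.
by rewrite big1 // => i _; apply: unip_mx_diag.
Qed.

(** The conjugate of the shift by [unip_mx y]; the adjugate is the inverse because the
determinant is 1, and it is visibly polynomial in [y]. *)
Definition conj_mx (y : 'I_low_var -> T) : 'M[T]_n :=
  \adj (unip_mx y) *m shift_mx T n' *m unip_mx y.

Lemma unip_mx_conj_mx y : unip_mx y *m conj_mx y = shift_mx T n' *m unip_mx y.
Proof. by rewrite /conj_mx !mulmxA mul_mx_adj det_unip_mx mul1mx. Qed.

Lemma conj_mx_unique y W : unip_mx y *m W = shift_mx T n' *m unip_mx y -> conj_mx y = W.
Proof.
by move=> gW; rewrite /conj_mx -mulmxA -gW mulmxA mul_adj_mx det_unip_mx mul1mx.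
Qed.

Lemma unip_mx_first_row y (j : 'I_n) : unip_mx y ord0 j = (j == 0 :> nat)%:R.
Proof.
have [->|j0] := eqVneq j ord0; first by rewrite unip_mx_diag.
rewrite unip_mx_low ?lt0n //; by move: j0; rewrite -val_eqE => /negPf ->.
Qed.

Lemma unip_mx_eq (g : 'M[T]_n) :
  (forall i j : 'I_n, (i < j)%N -> g i j = 0) -> (forall i, g i i = 1) ->
  unip_mx (fun k => let p := val (enum_val k) in g p.1 p.2) = g.
Proof.
move=> g_low g_diag; apply/matrixP => i j; rewrite mxE.
case: insubP => [t _ tE|]; first by rewrite enum_rankK tE.
rewrite -leqNgt /= leq_eqVlt => /orP[/eqP/val_inj <-|ij].
  by rewrite eqxx g_diag.
by rewrite -val_eqE ltn_eqF // g_low.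
Qed.
End Chart.

Lemma map_unip_mx (T U : comNzRingType) n' (f : {rmorphism T -> U}) y :
  map_mx f (unip_mx y) = unip_mx (n' := n') (f \o y).
Proof.
by apply/matrixP => i j; rewrite !mxE; case: insub => //; rewrite rmorph_nat.
Qed.

Lemma map_conj_mx (T U : comNzRingType) n' (f : {rmorphism T -> U}) y :
  map_mx f (conj_mx y) = conj_mx (n' := n') (f \o y).
Proof.
rewrite /conj_mx !map_mxM map_mx_adj map_unip_mx; congr (_ *m _ *m _).
by apply/matrixP => i j; rewrite !mxE rmorph_nat.
Qed.

(** * The cell and the common zeros are isomorphic *)
Section Points.
Variables (K : fieldType) (n' : nat) (h : hessenberg n'.+1).
Local Notation n := n'.+1.
Local Notation low_var := #|{: low_pos n}|.
Local Notation hess_var := #|{: hvar h}|.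

(* the two polynomial maps between the affine spaces *)
Definition to_flag (k : 'I_low_var) : {mpoly K[hess_var]} :=
  let p := val (enum_val k) in signed_row (kept_mx K h) p.1 p.2.

Definition to_matrix (v : 'I_hess_var) : {mpoly K[low_var]} :=
  let W := conj_mx (fun k => 'X_k) in
  match enum_val v with
  | inl i => - W (rev_ord i) (rev_ord i)
  | inr t => - W (rev_ord (val t).1) (rev_ord (val t).2)
  end.

Let flag_at z k := (to_flag k).@[z].
Let matrix_at y v := (to_matrix v).@[y].

Lemma flag_atE (z : 'I_hess_var -> K) k : flag_at z k =
  let p := val (enum_val k) in signed_row (kept_mx_at z) p.1 p.2.
Proof.
rewrite /flag_at /to_flag /signed_row rmorphM rmorphXn rmorphN1; congr (_ * _).
by rewrite /kept_mx_at -(rmorphXn (map_mx _)) mxE.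
Qed.

Lemma eval_conj_mx y : map_mx (meval y) (conj_mx (fun k => 'X_k)) = conj_mx y :> 'M[K]_n.
Proof.
by rewrite map_conj_mx; congr conj_mx; apply/boolp.funext => k /=; rewrite mevalXU.
Qed.

Lemma matrix_atE y v : matrix_at y v =
  match enum_val v with
  | inl i => - conj_mx y (rev_ord i) (rev_ord i)
  | inr t => - conj_mx y (rev_ord (val t).1) (rev_ord (val t).2)
  end.
Proof.
rewrite /matrix_at /to_matrix -eval_conj_mx.
by case: (enum_val v) => [i|t]; rewrite mevalN [in RHS]mxE.
Qed.

Lemma kept_mx_atE (z : 'I_hess_var -> K) : kept_mx_at z =
  hess_mx (fun i => z (enum_rank (inl i : hvar h)))
  (fun r s => if insub (r, s) is Some t
              then z (enum_rank (inr (t : hq_index h) : hvar h)) else 0).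
Proof.
rewrite /kept_mx_at map_hess_mx; apply/matrixP => r s; rewrite !mxE /= /kept_x mevalXU.
by rewrite /kept_q; case: insub => [t|]; rewrite ?mevalXU ?meval0.
Qed.

Lemma Hess_cell_pointsE (y : 'I_low_var -> K) : Hess_cell_points h y <->
  forall a b : 'I_n, (h b < a)%N -> conj_mx y a b = 0.
Proof.
have gE : lower_unip y = unip_mx y by [].
have dU : unip_mx y \in unitmx by rewrite unitmxE det_unip_mx unitr1.
have WE : invmx (unip_mx y) *m jordan_nilp K n *m unip_mx y = conj_mx y.
  by rewrite /conj_mx /invmx dU det_unip_mx invr1 scale1r.
rewrite /Hess_cell_points gE; split.
  by move=> [/(in_Hess_flag_of dU) + _]; rewrite WE.
move=> W0; split; first by apply/(in_Hess_flag_of dU); rewrite WE.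
by exists (unip_mx y) => //; split=> // i j; apply: unip_mx_low.
Qed.

Lemma not_kept (a b : 'I_n) : (b <= a)%N ->
  ~~ q_kept h (rev_ord a, rev_ord b) -> a != b -> (h b < a)%N.
Proof.
move=> ba; rewrite /q_kept rev_ordK /= -val_eqE /= => + ab.
have := ltn_ord a; have := ltn_ord b; have := ltn_ord (h b); lia.
Qed.

Lemma neg_rotK (M : 'M[K]_n) : neg_rot (neg_rot M) = M.
Proof. by apply/matrixP => i j; rewrite !mxE !rev_ordK opprK. Qed.

Lemma unip_mx_flag_at z : last_row_pow (kept_mx_at z) =1 (fun=> 0) ->
  unip_mx (flag_at z) = \matrix_(i, j) signed_row (kept_mx_at z) i j.
Proof.
move=> kz; rewrite -[RHS]unip_mx_eq.
- congr unip_mx; apply/boolp.funext => k; rewrite flag_atE /= mxE //.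
- move=> i j ij; rewrite mxE /signed_row kept_mx_atE hess_mx_pow_last; last first.
    by have := ltn_ord j; rewrite /=; lia.
  by rewrite ifF ?mulr0 //=; have := ltn_ord j; lia.
- move=> i; rewrite mxE /signed_row kept_mx_atE hess_mx_pow_last; last first.
    by have := ltn_ord i; rewrite /=; lia.
  rewrite ifT; first by rewrite -expr2 sqrr_sign.
  by have := ltn_ord i; rewrite /=; lia.
Qed.

Lemma conj_mx_flag_at z : last_row_pow (kept_mx_at z) =1 (fun=> 0) ->
  conj_mx (flag_at z) = neg_rot (kept_mx_at z).
Proof.
move=> kz; apply: conj_mx_unique; apply: signed_row_intertwines => // i j.
by rewrite unip_mx_flag_at // mxE.
Qed.

Lemma flag_at_in z : last_row_pow (kept_mx_at z) =1 (fun=> 0) -> Hess_cell_points h (flag_at z).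
Proof.
move=> kz; apply/Hess_cell_pointsE => a b hba.
have ba : (b < a)%N by apply: leq_ltn_trans hba; apply: hess_ge.
rewrite conj_mx_flag_at // mxE kept_mx_atE mxE ifF; last first.
  by apply/eqP => /rev_ord_inj ab; rewrite ab ltnn in ba.
rewrite ifF; last by have := ltn_ord a; rewrite /=; lia.
rewrite ifT ?insubN ?oppr0 //; last by have := ltn_ord a; rewrite /=; lia.
by rewrite /q_kept rev_ordK /=; have := ltn_ord a; lia.
Qed.

Lemma matrix_at_flag_at z : last_row_pow (kept_mx_at z) =1 (fun=> 0) ->
  matrix_at (flag_at z) =1 z.
Proof.
move=> kz v; rewrite matrix_atE conj_mx_flag_at // -[in RHS](enum_valK v).
case: (enum_val v) => [i|t]; rewrite mxE opprK !rev_ordK kept_mx_atE mxE ?eqxx //.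
case: t => [[r s] k]; have /andP[_ rs] := k.
rewrite /= -val_eqE ltn_eqF // ltn_eqF ?(ltnW rs) // ?ifT //.
by rewrite insubT.
Qed.

(** Below the diagonal the entries are forced by [intertwiner_superdiag]; in the
places of the dropped [q_rs] they vanish by the Hessenberg condition. *)
Lemma kept_mx_at_matrix_at y : Hess_cell_points h y ->
  kept_mx_at (matrix_at y) = neg_rot (conj_mx y).
Proof.
move/Hess_cell_pointsE => W0.
have W1 := intertwiner_superdiag (@unip_mx_low _ _ y) (@unip_mx_diag _ _ y) (unip_mx_conj_mx y).
apply/matrixP => r s; rewrite kept_mx_atE [LHS]mxE [RHS]mxE.
have [->|rs] := eqVneq r s; first by rewrite matrix_atE enum_rankK.
have [rE|rs1] := eqVneq (r : nat) s.+1.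
  rewrite W1 /=; last by have := ltn_ord r; lia.
  have -> : (n - s.+1 == (n - r.+1).+1)%N by have := ltn_ord r; lia.
  by [].
case: ifP => ltrs; last first.
  rewrite W1 /=; last by move: rs; rewrite -val_eqE /=; have := ltn_ord r; lia.
  have -> : (n - s.+1 == (n - r.+1).+1)%N = false.
    by move: rs; rewrite -val_eqE /=; have := ltn_ord r; lia.
  by rewrite oppr0.
case: insubP => [t _ tE|nk]; first by rewrite matrix_atE enum_rankK tE.
rewrite W0 ?oppr0 //; apply: not_kept; rewrite ?rev_ordK //.
  by rewrite /=; lia.
by apply: contraNneq rs => /rev_ord_inj ->.
Qed.

Lemma matrix_at_in y : Hess_cell_points h y ->
  last_row_pow (kept_mx_at (matrix_at y)) =1 (fun=> 0) /\ flag_at (matrix_at y) =1 y.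
Proof.
move=> yP; have ME := kept_mx_at_matrix_at yP.
have [|gE kry] := @intertwines_signed_row _ _ (kept_mx_at (matrix_at y)) (unip_mx y)
  (unip_mx_first_row y).
  by rewrite ME neg_rotK unip_mx_conj_mx.
split=> // k; rewrite flag_atE /= -gE mxE.
by rewrite -surjective_pairing valK enum_valK.
Qed.
End Points.

(** * Coordinate rings *)
Section QuotPi.
Variables (K : comNzRingType) (A : comAlgType K).

Lemma quot_piE (I : idealr A) a b : (quot_pi I a == quot_pi I b) = (a - b \in I).
Proof. by rewrite Quotient.idealrBE. Qed.

Lemma quot_piK (I : idealr A) (x : quot_alg I) : quot_pi I (repr x) = x.
Proof. exact: reprK. Qed.
End QuotPi.

Section QuotMap.
Variables (K : comNzRingType) (A B : comAlgType K).
Variables (I : idealr A) (J : idealr B) (F : {lrmorphism A -> B}).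

(** The compatibility of [F] with the ideals is an argument so that the morphism
structures below can be attached to this map. *)
Definition quot_map (_ : forall a, a \in I -> F a \in J) (x : quot_alg I) : quot_alg J :=
  quot_pi J (F (repr x)).

Hypothesis FIJ : forall a, a \in I -> F a \in J.
Local Notation f := (quot_map FIJ).

Lemma quot_map_pi a : f (quot_pi I a) = quot_pi J (F a).
Proof.
apply/eqP; rewrite quot_piE -rmorphB FIJ // -quot_piE.
by rewrite quot_piK.
Qed.
End QuotMap.

Section QuotMapMorph.
Variables (K : comNzRingType) (A B : comAlgType K).
Variables (I : idealr A) (J : idealr B) (F : {lrmorphism A -> B}).
Variable FIJ : forall a, a \in I -> F a \in J.
Local Notation f := (quot_map FIJ).

Lemma quot_map_zmod : zmod_morphism f.
Proof.
move=> x y; rewrite -(quot_piK x) -(quot_piK y).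
have piB (U : comAlgType K) (L : idealr U) a b : quot_pi L (a - b) = quot_pi L a - quot_pi L b.
  by rewrite -scaleN1r quot_piD quot_piZ scaleN1r.
by rewrite -piB !quot_map_pi rmorphB piB.
Qed.
Lemma quot_map_monoid : monoid_morphism f.
Proof.
split; first by rewrite -quot_pi1 quot_map_pi rmorph1 quot_pi1.
move=> x y; rewrite -(quot_piK x) -(quot_piK y).
by rewrite -quot_piM !quot_map_pi rmorphM quot_piM.
Qed.
Lemma quot_map_scalable : scalable f.
Proof.
move=> c x; rewrite -(quot_piK x).
by rewrite -quot_piZ !quot_map_pi linearZ quot_piZ.
Qed.

HB.instance Definition _ := GRing.isZmodMorphism.Build _ _ f quot_map_zmod.
HB.instance Definition _ := GRing.isMonoidMorphism.Build _ _ f quot_map_monoid.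
HB.instance Definition _ := GRing.isScalable.Build _ _ _ _ f quot_map_scalable.
Definition quot_lrmorphism : {lrmorphism quot_alg I -> quot_alg J} := f.
End QuotMapMorph.

Section CoordinateRings.
Variables (K : comNzRingType) (m p : nat).
Variables (I : idealr {mpoly K[m]}) (J : idealr {mpoly K[p]}).
Variables (Y : ('I_m -> K) -> Prop) (Z : ('I_p -> K) -> Prop).
Hypothesis I_Y : forall f, f \in I <-> forall y, Y y -> f.@[y] = 0.
Hypothesis J_Z : forall f, f \in J <-> forall z, Z z -> f.@[z] = 0.
Variables (u : 'I_m -> {mpoly K[p]}) (v : 'I_p -> {mpoly K[m]}).
Local Notation u_at z := (fun i => (u i).@[z]).
Local Notation v_at y := (fun i => (v i).@[y]).
Hypothesis u_in : forall z, Z z -> Y (u_at z).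
Hypothesis v_in : forall y, Y y -> Z (v_at y).
Hypothesis uK : forall z, Z z -> v_at (u_at z) =1 z.
Hypothesis vK : forall y, Y y -> u_at (v_at y) =1 y.

Let pull_u : {lrmorphism {mpoly K[m]} -> {mpoly K[p]}} := comp_mpoly [tuple u i | i < m].
Let pull_v : {lrmorphism {mpoly K[p]} -> {mpoly K[m]}} := comp_mpoly [tuple v i | i < p].

Lemma eval_pull_u f z : (pull_u f).@[z] = f.@[u_at z].
Proof. by rewrite /pull_u /= comp_mpoly_meval; apply: meval_eq => i; rewrite tnth_mktuple. Qed.
Lemma eval_pull_v f y : (pull_v f).@[y] = f.@[v_at y].
Proof. by rewrite /pull_v /= comp_mpoly_meval; apply: meval_eq => i; rewrite tnth_mktuple. Qed.

(** Functions on [Y] and on [Z] are pulled back along the two mutually inverse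
polynomial maps. *)
Lemma coordinate_rings_iso :
  exists f : {lrmorphism quot_alg I -> quot_alg J}, bijective f.
Proof.
have uIJ a : a \in I -> pull_u a \in J.
  by move/I_Y => a0; apply/J_Z => z Zz; rewrite eval_pull_u a0 //; apply: u_in.
have vJI a : a \in J -> pull_v a \in I.
  by move/J_Z => a0; apply/I_Y => y Yy; rewrite eval_pull_v a0 //; apply: v_in.
exists (quot_lrmorphism uIJ); exists (quot_lrmorphism vJI) => x.
- rewrite -(quot_piK x) /= !quot_map_pi; apply/eqP; rewrite quot_piE.
  apply/I_Y => y Yy; rewrite mevalB eval_pull_v eval_pull_u.
  by apply/eqP; rewrite subr_eq0; apply/eqP/meval_eq/vK.
- rewrite -(quot_piK x) /= !quot_map_pi; apply/eqP; rewrite quot_piE.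
  apply/J_Z => z Zz; rewrite mevalB eval_pull_u eval_pull_v.
  by apply/eqP; rewrite subr_eq0; apply/eqP/meval_eq/uK.
Qed.
End CoordinateRings.

Lemma complex_infinite_fiber (R : realType) (e : R[i] -> nat) :
  exists j, forall s : seq R[i], exists2 x, x \notin s & e x = j.
Proof.
have [j jP] := real_infinite_fiber (fun x : R => e (x +i* 0)%C).
exists j => s; have [x xs ex] := jP [seq complex.Re z | z <- s].
exists (x +i* 0)%C => //; apply: contra xs => xs.
by apply/mapP; exists (x +i* 0)%C.
Qed.

Theorem corollary1p3 (R : realType) (n : nat) (hn : (0 < n)%N)
    (h : hessenberg n) (hind : indecomposable h) :
  exists f : {lrmorphism Hess_cell_coord_ring R h -> hE_quotient R h},
    bijective f.
Proof.
case: n hn h hind => // n' _ h hind.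
apply: (@coordinate_rings_iso R[i] _ _ _ _ (Hess_cell_points h)
  (fun z => last_row_pow (kept_mx_at z) =1 (fun=> 0))
  _ _ (@to_flag R[i] n' h) (@to_matrix R[i] n' h)).
- by move=> f; split=> [/asboolP|f0]; [|apply/asboolP].
- exact: hE_ideal_zeros (@complex_infinite_fiber R) hind.
- exact: flag_at_in.
- by move=> y /matrix_at_in[].
- exact: matrix_at_flag_at.
- by move=> y /matrix_at_in[].
Qed.
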